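(* Let $\mathcal{Z}=\mathcal{X}\times\mathcal{Y}\subseteq\mathbb{R}^d$ be non-empty, closed and convex, with $\|z_1-z_2\|\le D$ for all $z_1,z_2\in\mathcal{Z}$, where $D>0$. Let $0<\delta\le L$ and let $f_1,\dots,f_n:\mathbb{R}^{d_x}\times\mathbb{R}^{d_y}\to\mathbb{R}$ be twice differentiable, $L$-smooth, convex-concave, with $\delta$-second-order similarity. Let $\varepsilon>0$ and run SVOGS with $$b=\lceil\sqrt{n}\,\rceil,\quad \gamma=p=\frac{1}{\sqrt{n}+8},\quad \eta=\min\Big\{\frac{\sqrt{\gamma b}}{4\delta},\frac{1}{32\delta}\Big\},\quad \alpha=1,$$ $$\varepsilon_k=\min\big\{\zeta,\ \hat c^{-1}\min\{\|\hat u^k-z^k\|,\|\hat u^k-z^k\|^2\}\big\},$$ where $$\zeta=\min\left\{\frac{\eta^2\varepsilon^2}{16\big(9\eta LD+3\eta\max_{i\in[n]}\|F_i(z^0)\|+D\big)^2},\ \frac{\eta\varepsilon}{4(12\eta^2\delta^2+1)}\right\},\qquad \hat c=100+2048\eta^2\delta^2+64\sqrt{2\eta\Phi^0}.$$ Then, with $u_{\rm avg}^K=\frac1K\sum_{k=0}^{K-1}u^k$, SVOGS achieves $\mathbb{E}[\operatorname{Gap}(u_{\rm avg}^K)]\le\varepsilon$ within $\mathcal{O}(\delta D^2/\varepsilon)$ communication rounds, communication complexity $\mathcal{O}(n+\sqrt{n}\,\delta D^2/\varepsilon)$, and local gradient complexity $\tilde{\mathcal{O}}\big(n+\frac{(\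sqrt{n}\delta+L)D^2}{\varepsilon}\log\frac1\varepsilon\big)$.
   Context: Problem: $\min_{x\in\mathcal{X}}\max_{y\in\mathcal{Y}} f(x,y):=\frac1n\sum_{i=1}^n f_i(x,y)$, with $\mathcal{X}\subseteq\mathbb{R}^{d_x}$, $\mathcal{Y}\subseteq\mathbb{R}^{d_y}$, $d=d_x+d_y$, $z=(x,y)$, $[n]=\{1,\dots,n\}$. $\operatorname{Gap}(x,y)=\max_{y'\in\mathcal{Y}}f(x,y')-\min_{x'\in\mathcal{X}}f(x',y)$. Write $F_i(z)=[\nabla_x f_i(x,y);-\nabla_y f_i(x,y)]$ and $F=\frac1n\sum_{i=1}^n F_i$. ''$L$-smooth'': $\|F_i(z_1)-F_i(z_2)\|\le L\|z_1-z_2\|$ for all $i$ and $z_1,z_2\in\mathbb{R}^d$. ''Convex-concave'': convex in $x$ for fixed $y$ and concave in $y$ for fixed $x$. ''$\delta$-second-order similarity'': $\|\nabla^2 f_i(x,y)-\nabla^2 f(x,y)\|\le\delta$ for all $i,x,y$ (spectral norm). Algorithm SVOGS. Input: $z^0\in\mathcal{Z}$, step size $\eta>0$, accuracies $\varepsilon_k$, number of iterations $K$, mini-batch size $b$, probability $p\in(0,1]$, weights $\alpha,\gamma$. Initialize $w^{-1}=z^{-1}=w^0=z^0$. For $k=0,\dots,K-1$: (1) $\bar z^k=(1-\gamma)z^k+\gamma w^k$. (2) Sample $\mathcal{S}^k=\{j_1^k,\dots,j_b^k\}$ uniformly and independently from $[n]$. (3) $\delta^k=F(w^{k-1})-F_1(w^{k-1})+\frac1b\sum_{j\in\mathcal{S}^k}\big(F_j(z^k)-F_1(z^k)-F_j(w^{k-1})+F_1(w^{k-1})\big)+\frac{\alpha}{b}\sum_{j\in\mathcal{S}^k}\big(F_j(z^k)-F_1(z^k)-F_j(z^{k-1})+F_1(z^{k-1})\big)$.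 (4) $v^k=(v^k_x,v^k_y)=\bar z^k-\eta\delta^k$. (5) Find $u^k\in\mathbb{R}^d$ with $\|u^k-\hat u^k\|^2\le\varepsilon_k$, where $\hat u^k$ is the solution of $\min_{\hat x\in\mathcal{X}}\max_{\hat y\in\mathcal{Y}}\{f_1(\hat x,\hat y)+\frac1{2\eta}\|\hat x-v^k_x\|^2-\frac1{2\eta}\|\hat y-v^k_y\|^2\}$. (6) $z^{k+1}=u^k$. (7) $w^{k+1}=z^{k+1}$ with probability $p$, and $w^{k+1}=w^k$ with probability $1-p$. Expectation is over the random sets $\mathcal{S}^k$ and the random updates in (7). $\Phi^0=\frac1\eta\|z^0-z^*\|^2+\frac{\gamma}{p\eta}\|w^0-z^*\|^2$, where $z^*\in\mathcal{Z}$ is a solution (saddle point) of the problem. Complexity conventions: $f_1$ is held by the server and $f_2,\dots,f_n$ by clients. Each iteration is one communication round. Communication complexity is the total (expected) number of client-server vector exchanges, where exchanging with a batch of $b$ clients costs $b$ (so an iteration where $w$ is unchanged costs $O(b)$, and one needing a new full gradient $F(w)$ costs $O(n)$; initialization costs $O(n)$). Local gradient complexity is the total (expected) number of evaluations of the local gradients of the $f_i$, including those used by the server to solve step (5), which is solved on the server by a first-order method for smooth strongly-convex-strongly-concave problems (e.g. extra-gradient) without communication. $\mathcal{O}$ hides constants independent of the problem parameters; $\tilde{\mathcal{O}}$ additionally hides logarithmic factors of $n,L,\mu,\delta$.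
   Formalization: In the local gradient bound D²/ε is replaced by max(D²/ε, 1/δ) and log(1/ε) by max(1, log(1/ε)), and the factor hidden by Õ also includes logarithms of D and of max_i ‖F_i(z^0)‖; the number of rounds is the integer ceiling of C·δD²/ε. *)

(* Defs.v *)
From mathcomp Require Import all_boot all_order all_algebra.
From mathcomp Require Import all_classical all_reals all_analysis.

Set Implicit Arguments.
Unset Strict Implicit.
Unset Printing Implicit Defensive.

Import Order.TTheory GRing.Theory Num.Theory.
Import numFieldNormedType.Exports.

Local Open Scope classical_set_scope.
Local Open Scope ring_scope.

(* The library norm on row vectors is the sup norm (it induces the right
   topology and the right notion of differentiability); the Euclidean and the
   spectral norms are defined here. *)
Definition enorm (R : realType) (m : nat) (v : 'rV[R]_m) : R :=
  Num.sqrt (\sum_(i < m) v 0 i ^+ 2).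

Definition specnorm (R : realType) (m : nat) (A : 'M[R]_m) : R :=
  sup [set enorm (v *m A) | v in [set v : 'rV[R]_m | enorm v <= 1]].

Definition grad (R : realType) (m : nat) (f : 'rV[R]_m -> R) (v : 'rV[R]_m) :
    'rV[R]_m :=
  \row_i 'D_(delta_mx 0 i) f v.

Definition hessian (R : realType) (m : nat) (f : 'rV[R]_m -> R)
    (v : 'rV[R]_m) : 'M[R]_m :=
  jacobian (grad f) v.

Definition twice_differentiable (R : realType) (m : nat)
    (f : 'rV[R]_m -> R) : Prop :=
  (forall v, differentiable f v) /\ (forall v, differentiable (grad f) v).

(* A pair z = (x, y) is encoded as row_mx x y, so that x = lsubmx z and
   y = rsubmx z; a function of (x, y) is a function on 'rV_(dx + dy). *)
Section Minimax.
Variables (R : realType) (dx dy : nat).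
Local Notation vec := 'rV[R]_(dx + dy).
Implicit Types (X : set 'rV[R]_dx) (Y : set 'rV[R]_dy) (f phi : vec -> R).

Definition prodset X Y : set vec :=
  [set z | X (lsubmx z) /\ Y (rsubmx z)].

(* [grad_x f; - grad_y f] *)
Definition gradop f (z : vec) : vec :=
  row_mx (grad (fun x => f (row_mx x (rsubmx z))) (lsubmx z))
         (- grad (fun y => f (row_mx (lsubmx z) y)) (rsubmx z)).

Definition convex_concave f : Prop :=
  (forall y, convex_function setT (fun x => f (row_mx x y))) /\
  (forall x, convex_function setT (fun y => - f (row_mx x y))).

Definition saddle X Y phi (z : vec) : Prop :=
  [/\ prodset X Y z,
      forall x, X x -> phi z <= phi (row_mx x (rsubmx z))
    & forall y, Y y -> phi (row_mx (lsubmx z) y) <= phi z].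

(* For X, Y compact and f continuous the sup and inf are attained. *)
Definition Gap X Y f (z : vec) : R :=
  sup [set f (row_mx (lsubmx z) y) | y in Y] -
  inf [set f (row_mx x (rsubmx z)) | x in X].

Definition is_proj (Z : set vec) (v q : vec) : Prop :=
  Z q /\ forall q', Z q' -> enorm (v - q) <= enorm (v - q').

Definition proj (Z : set vec) (v : vec) : vec := xget v (is_proj Z v).

(* One extra-gradient step with step size tau for the operator G over Z: two
   evaluations of G. *)
Definition eg_step (Z : set vec) (G : vec -> vec) (tau : R) (z : vec) : vec :=
  let zhalf := proj Z (z - tau *: G z) in
  proj Z (z - tau *: G zhalf).

(* Objective of the regularized subproblem, and its [grad_x; - grad_y]
   operator. *)
Definition sub_obj (f1 : vec -> R) (eta : R) (v z : vec) : R :=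
  f1 z + (2 * eta)^-1 * enorm (lsubmx z - lsubmx v) ^+ 2
       - (2 * eta)^-1 * enorm (rsubmx z - rsubmx v) ^+ 2.

Definition sub_op (f1 : vec -> R) (eta : R) (v z : vec) : vec :=
  gradop f1 z + eta^-1 *: (z - v).

Section FiniteSum.
Variables (n : nat) (f : 'I_n -> vec -> R).

Definition favg (z : vec) : R := n%:R^-1 * \sum_(i < n) f i z.

Definition Favg (z : vec) : vec := n%:R^-1 *: \sum_(i < n) gradop (f i) z.

Definition smooth (L : R) : Prop :=
  forall i z1 z2,
    enorm (gradop (f i) z1 - gradop (f i) z2) <= L * enorm (z1 - z2).

Definition second_order_similar (delta : R) : Prop :=
  forall i z, specnorm (hessian (f i) z - hessian favg z) <= delta.

Definition max_init_norm (z0 : vec) : R :=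
  \big[Num.max/0]_(i < n) enorm (gradop (f i) z0).

End FiniteSum.
End Minimax.

(* Randomness of K iterations: at each iteration b indices of [n] (with
   repetition) and the coin deciding whether w is refreshed, all independent,
   the indices uniform and the coin of parameter p. *)
Definition draw (n b : nat) : finType := (b.-tuple 'I_n * bool)%type.
Definition outcome (n b K : nat) : finType := {ffun 'I_K -> draw n b}.

Definition weight (R : realType) (n b K : nat) (p : R)
    (om : outcome n b K) : R :=
  \prod_(k < K) ((n%:R^-1) ^+ b * (if (om k).2 then p else 1 - p)).

Definition Expect (R : realType) (n b K : nat) (p : R)
    (Xi : outcome n b K -> R) : R :=
  \sum_(om : outcome n b K) weight p om * Xi om.

Record trace (R : realType) (d n b K : nat) := Trace {
  zs : nat -> outcome n b K -> 'rV[R]_d;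
  ws : nat -> outcome n b K -> 'rV[R]_d;
  us : nat -> outcome n b K -> 'rV[R]_d;
  uhats : nat -> outcome n b K -> 'rV[R]_d }.

Section Svogs.
Variables (R : realType) (dx dy n b K : nat).
Local Notation vec := 'rV[R]_(dx + dy).
Local Notation Omega := (outcome n b K).
Variables (X : set 'rV[R]_dx) (Y : set 'rV[R]_dy).
Variables (f : 'I_n -> vec -> R) (i1 : 'I_n).
Variables (eta gamma alpha : R).

Definition zbar (tr : trace R (dx + dy) n b K) (k : nat) (om : Omega) : vec :=
  (1 - gamma) *: zs tr k om + gamma *: ws tr k om.

(* Since 0.-1 = 0, the index k.-1 implements z^(-1) = z^0 and w^(-1) = w^0. *)
Definition delta_est (tr : trace R (dx + dy) n b K) (k : 'I_K) (om : Omega) :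
    vec :=
  let F j := gradop (f j) in
  let zk := zs tr k om in
  let zp := zs tr k.-1 om in
  let wp := ws tr k.-1 om in
  let S := (om k).1 in
  Favg f wp - F i1 wp
  + b%:R^-1 *: (\sum_(j <- S) (F j zk - F i1 zk - F j wp + F i1 wp))
  + (alpha / b%:R) *: (\sum_(j <- S) (F j zk - F i1 zk - F j zp + F i1 zp)).

Definition vvec (tr : trace R (dx + dy) n b K) (k : 'I_K) (om : Omega) : vec :=
  zbar tr k om - eta *: delta_est tr k om.

(* tr is an execution of K iterations of SVOGS from z0, with accuracies
   eps_k, which may depend on the past. The choice of u^k within its tolerance
   is arbitrary, but it can only depend on the randomness revealed so far. *)
Record svogs_run (z0 : vec) (eps : nat -> Omega -> R)
    (tr : trace R (dx + dy) n b K) : Prop := SvogsRun {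
  run_z0 : forall om, zs tr 0%N om = z0;
  run_w0 : forall om, ws tr 0%N om = z0;
  run_uhat : forall (k : 'I_K) om,
    saddle X Y (sub_obj (f i1) eta (vvec tr k om)) (uhats tr k om);
  run_u : forall (k : 'I_K) om,
    enorm (us tr k om - uhats tr k om) ^+ 2 <= eps k om;
  run_u_adapted : forall (k : 'I_K) (om om' : Omega),
    (forall j : 'I_K, (j < k)%N -> om j = om' j) ->
    (om k).1 = (om' k).1 ->
    us tr k om = us tr k om';
  run_z : forall (k : 'I_K) om, zs tr k.+1 om = us tr k om;
  run_w : forall (k : 'I_K) om,
    ws tr k.+1 om = if (om k).2 then zs tr k.+1 om else ws tr k om }.

Definition uavg (tr : trace R (dx + dy) n b K) (om : Omega) : vec :=
  K%:R^-1 *: \sum_(k < K) us tr k om.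

(* u^k is the iterate number T k of extra-gradient on the k-th subproblem,
   started at z^k; the operator of the subproblem is eta^-1-strongly monotone
   and (L + eta^-1)-Lipschitz. *)
Definition solved_by_eg (L : R) (tr : trace R (dx + dy) n b K)
    (T : nat -> Omega -> nat) : Prop :=
  forall (k : 'I_K) om,
    us tr k om =
      iter (T k om)
        (eg_step (prodset X Y) (sub_op (f i1) eta (vvec tr k om))
                 (4 * (L + eta^-1))^-1)
        (zs tr k om).

End Svogs.

(* Exchanging with a batch of m clients costs m: the batch has size n for the
   initial full gradient, b at every iteration, and n again whenever w is
   refreshed. *)
Definition comm_cost (R : realType) (n b K : nat) (om : outcome n b K) : R :=
  (n + \sum_(k < K) (b + (if (om k).2 then n else 0)))%N%:R.

(* Evaluations of local gradients: those of the full gradients; F_j and F_1 at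
   the three points z^k, z^(k-1), w^(k-1) for each sampled j; two per
   extra-gradient step, T k being the number of such steps at iteration k. *)
Definition grad_cost (R : realType) (n b K : nat)
    (T : nat -> outcome n b K -> nat) (om : outcome n b K) : R :=
  (n + \sum_(k < K) (6 * b + (if (om k).2 then n else 0) + 2 * T k om))%N%:R.

(* The factor hidden by the tilde of the O-tilde notation. *)
Definition log_factor (R : realType) (n : nat) (L delta D M : R) : R :=
  1 + ln n%:R + `|ln L| + `|ln delta| + `|ln D| + ln (1 + M).

(* Main.v *)
(* Put G = F - F_1, which is delta-Lipschitz by second-order similarity. The
   estimator delta^k has conditional mean G(z^k) + (G(z^k) - G(z^(k-1))) and, the
   batch being i.i.d., conditional variance at most
   2 delta^2 / b (|z^k - w^(k-1)|^2 + |z^k - z^(k-1)|^2).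
   For a fixed z, the variational inequality satisfied by the exact solution
   of the subproblem bounds <F(u^k), u^k - z> by the decrease of
   16 delta ((1 - gamma) |z^k - z|^2 + |w^k - z|^2) minus multiples of
   delta |uhat^k - z^k|^2 and gamma delta |uhat^k - w^k|^2, up to noise and inexactness.
   The gap takes the maximum over z before the expectation; since the noise terms
   are affine in z, this costs only D times the norms of two martingales, the
   sums of the estimation errors and of
   w^(k+1) - gamma z^(k+1) - (1 - gamma) w^k. Orthogonality of their increments
   turns the squared norms into sums of variances, which the negative terms
   absorb because 1 / b <= 9 gamma. The total regret is O(delta D^2) plus
   K epsilon / 4.
   A run that uses a fixed number of extra-gradient steps exists because each
   step is a contraction towards the solution of the subproblem. That solution is
   found by minimizing |phi(z) - z| over the compact set Z, phi being the projected
   gradient step, a strict contraction. *)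

Require Import Defs.
From mathcomp Require Import all_boot all_order all_algebra.
From mathcomp Require Import all_classical all_reals all_analysis.
From mathcomp Require Import ring lra.

Set Implicit Arguments.
Unset Strict Implicit.
Unset Printing Implicit Defensive.

Import Order.TTheory GRing.Theory Num.Theory.
Import numFieldNormedType.Exports.

Local Open Scope classical_set_scope.
Local Open Scope ring_scope.

(** * Euclidean geometry of row vectors *)

(** The iterate u^k is inexact and may lie outside Z, so distances are controlled through uhat^k,
    which lies in Z. The tolerance works on two scales. Its relative part gives |u^k - uhat^k| <=
    |uhat^k - z^k| / 10, which keeps every iterate within 5 D / 4 of each point of Z and makes the
    quadratic errors absorbable; its absolute part zeta pays for the errors linear in |u^k -
    uhat^k|, at most epsilon / 4 per step. The comparator z of the gap depends on the outcome, so
    every noise term is recentred at the fixed point z^0: the part attached to z^0 has mean zero,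
    and only the part linear in z - z^0 goes through Cauchy-Schwarz. The point uhat^k enters only
    inequalities valid for each outcome; averaging over a single draw is applied to expressions in
    z^k and w^k, whose dependence on the draws is known. Since gamma b >= 1 / 9, the minimum
    defining eta is always 1 / (32 delta); hence the weight 16 delta = 1 / (2 eta) throughout. *)

Definition dot (R : realType) (m : nat) (u v : 'rV[R]_m) : R :=
  \sum_(i < m) u 0 i * v 0 i.

Section Euclid.
Variables (R : realType) (m : nat).
Implicit Types (u v w : 'rV[R]_m) (a b : R).

Lemma dotC u v : dot u v = dot v u.
Proof. by apply: eq_bigr => i _; rewrite mulrC. Qed.

Lemma dotDl u v w : dot (u + v) w = dot u w + dot v w.
Proof. by rewrite -big_split; apply: eq_bigr => i _; rewrite mxE mulrDl. Qed.

Lemma dotZl a u v : dot (a *: u) v = a * dot u v.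
Proof. by rewrite mulr_sumr; apply: eq_bigr => i _; rewrite mxE mulrA. Qed.

Lemma dotNl u v : dot (- u) v = - dot u v.
Proof. by rewrite -scaleN1r dotZl mulN1r. Qed.

Lemma dotBl u v w : dot (u - v) w = dot u w - dot v w.
Proof. by rewrite dotDl dotNl. Qed.

Lemma dot0l u : dot 0 u = 0.
Proof. by rewrite -(scale0r 0) dotZl mul0r. Qed.

Lemma dotDr u v w : dot w (u + v) = dot w u + dot w v.
Proof. by rewrite ![dot w _]dotC dotDl. Qed.

Lemma dotZr a u v : dot v (a *: u) = a * dot v u.
Proof. by rewrite ![dot v _]dotC dotZl. Qed.

Lemma dotNr u v : dot v (- u) = - dot v u.
Proof. by rewrite ![dot v _]dotC dotNl. Qed.

Lemma dotBr u v w : dot w (u - v) = dot w u - dot w v.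
Proof. by rewrite ![dot w _]dotC dotBl. Qed.

Lemma dot0r u : dot u 0 = 0.
Proof. by rewrite dotC dot0l. Qed.

Lemma dot_suml (I : Type) (r : seq I) (P : pred I) (F : I -> 'rV[R]_m) v :
  dot (\sum_(i <- r | P i) F i) v = \sum_(i <- r | P i) dot (F i) v.
Proof.
by elim/big_rec2 : _ => [|i x y _ <-]; [exact: dot0l|rewrite dotDl].
Qed.

Lemma dot_sumr (I : Type) (r : seq I) (P : pred I) (F : I -> 'rV[R]_m) v :
  dot v (\sum_(i <- r | P i) F i) = \sum_(i <- r | P i) dot v (F i).
Proof. by rewrite dotC dot_suml; apply: eq_bigr => i _; rewrite dotC. Qed.

Lemma dot_ge0 u : 0 <= dot u u.
Proof. by apply: sumr_ge0 => i _; rewrite -expr2 sqr_ge0. Qed.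

Lemma enorm_sqr u : enorm u ^+ 2 = dot u u.
Proof.
rewrite /enorm sqr_sqrtr; last by apply: sumr_ge0 => i _; rewrite sqr_ge0.
by apply: eq_bigr => i _; rewrite expr2.
Qed.

Lemma enorm_ge0 u : 0 <= enorm u.
Proof. exact: sqrtr_ge0. Qed.

Lemma enorm_eq0 u : enorm u = 0 -> u = 0.
Proof.
move=> u0; have : dot u u = 0 by rewrite -enorm_sqr u0 expr0n.
move/eqP; rewrite psumr_eq0; last by move=> i _; rewrite -expr2 sqr_ge0.
move=> /allP h; apply/rowP => i; rewrite mxE.
have /h /= : i \in index_enum 'I_m by rewrite mem_index_enum.
by rewrite -expr2 sqrf_eq0 => /eqP.
Qed.

Lemma enorm0 : enorm (0 : 'rV[R]_m) = 0.
Proof.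
by apply/eqP; rewrite -sqrf_eq0 enorm_sqr dot0l.
Qed.

Lemma enormZ a u : enorm (a *: u) = `|a| * enorm u.
Proof.
apply/eqP; rewrite -(@eqrXn2 _ 2) ?enorm_ge0 ?mulr_ge0 ?enorm_ge0//.
by rewrite exprMn real_normK ?num_real// !enorm_sqr dotZl dotZr mulrA expr2.
Qed.

Lemma enormN u : enorm (- u) = enorm u.
Proof. by rewrite -scaleN1r enormZ normrN1 mul1r. Qed.

Lemma enormC u v : enorm (u - v) = enorm (v - u).
Proof. by rewrite -opprB enormN. Qed.

Lemma dot_le u v : dot u v <= enorm u * enorm v.
Proof.
have [/enorm_eq0 ->|u0] := eqVneq (enorm u) 0; first by rewrite enorm0 mul0r dot0l.
have [/enorm_eq0 ->|v0] := eqVneq (enorm v) 0; first by rewrite enorm0 mulr0 dot0r.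
have := dot_ge0 (enorm v *: u - enorm u *: v).
rewrite !(dotBl, dotBr, dotZl, dotZr) -!enorm_sqr (dotC v u) => h.
have up : 0 < enorm u by rewrite lt_def u0 enorm_ge0.
have vp : 0 < enorm v by rewrite lt_def v0 enorm_ge0.
have : enorm u * enorm v * dot u v <= enorm u * enorm v * (enorm u * enorm v).
  by lra.
by rewrite ler_pM2l// mulr_gt0.
Qed.

Lemma dot_ge u v : - (enorm u * enorm v) <= dot u v.
Proof. by rewrite lerNl -dotNl -(enormN u) dot_le. Qed.

Lemma enormD u v : enorm (u + v) <= enorm u + enorm v.
Proof.
rewrite -(@ler_pXn2r _ 2) ?nnegrE ?addr_ge0 ?enorm_ge0//.
rewrite enorm_sqr !(dotDl, dotDr) (dotC v u) -!enorm_sqr.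
have := dot_le u v; lra.
Qed.

Lemma enorm_triang u v w : enorm (u - w) <= enorm (u - v) + enorm (v - w).
Proof. by rewrite -[u - w](subrKA v) enormD. Qed.

Lemma enormD_sqr u v : enorm (u + v) ^+ 2 <= 2 * enorm u ^+ 2 + 2 * enorm v ^+ 2.
Proof.
have h : enorm (u + v) ^+ 2 <= (enorm u + enorm v) ^+ 2.
  by rewrite ler_pXn2r ?nnegrE ?addr_ge0 ?enorm_ge0// enormD.
have := sqr_ge0 (enorm u - enorm v); lra.
Qed.

Lemma enorm_sum (I : Type) (r : seq I) (P : pred I) (F : I -> 'rV[R]_m) :
  enorm (\sum_(i <- r | P i) F i) <= \sum_(i <- r | P i) enorm (F i).
Proof.
elim/big_rec2 : _ => [|i x y _ h]; first by rewrite enorm0.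
exact: le_trans (enormD _ _) (lerD _ _).
Qed.

(** Turns the inner products of a variational inequality into differences of squared distances,
    which telescope. *)
Lemma dot_three_point (u v z : 'rV[R]_m) :
  2 * dot (u - v) (z - u) =
  enorm (v - z) ^+ 2 - enorm (u - z) ^+ 2 - enorm (u - v) ^+ 2.
Proof.
rewrite !enorm_sqr !(dotBl, dotBr) (dotC z v) (dotC z u) (dotC v u); ring.
Qed.

Lemma enorm_sqrD u v : enorm (u + v) ^+ 2 = enorm u ^+ 2 + 2 * dot u v + enorm v ^+ 2.
Proof. rewrite !enorm_sqr !(dotDl, dotDr) (dotC v u); ring. Qed.

Lemma enorm_sqrB u v : enorm (u - v) ^+ 2 = enorm u ^+ 2 - 2 * dot u v + enorm v ^+ 2.
Proof. by rewrite enorm_sqrD dotNr enormN mulrN. Qed.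

Lemma enorm_coord u i : `|u 0 i| <= enorm u.
Proof.
rewrite -(@ler_pXn2r _ 2) ?nnegrE ?enorm_ge0// real_normK ?num_real//.
rewrite enorm_sqr /dot (bigD1 i)//= -expr2 lerDl sumr_ge0// => j _.
by rewrite -expr2 sqr_ge0.
Qed.

Lemma enorm_le_sum u : enorm u <= \sum_i `|u 0 i|.
Proof.
rewrite -(@ler_pXn2r _ 2) ?nnegrE ?enorm_ge0 ?sumr_ge0//.
rewrite enorm_sqr expr2 mulr_suml; apply: ler_sum => i _.
apply: le_trans (ler_norm _) _; rewrite normrM ler_wpM2l//.
by rewrite (bigD1 i)//= lerDl sumr_ge0.
Qed.

(** The ambient topology is that of the sup norm. Passing to it costs the factor [m], and the [+ 1]
    in the proof keeps the radius positive when [C] or [m] vanishes. *)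
Lemma enorm_lipschitz_continuous (g : 'rV[R]_m -> R) (C : R) :
  (forall u v, `|g u - g v| <= C * enorm (u - v)) -> continuous g.
Proof.
move=> gC u; apply/(@cvgrPdist_le _ _ _ (nbhs u) _ g (g u)) => e e0.
have K0 : 0 < `|C| * m%:R + 1 by rewrite ltr_wpDl// mulr_ge0.
apply/(@nbhs_ballP R 'rV[R]_m); exists ((`|C| * m%:R + 1)^-1 * e) => /=.
  by rewrite mulr_gt0 ?invr_gt0.
move=> v; rewrite -ball_normE/= => /ltW uv; apply: le_trans (gC u v) _.
apply: (@le_trans _ _ ((`|C| * m%:R + 1) * `|u - v|)).
  rewrite mulrDl mul1r; apply: le_trans (_ : `|C| * m%:R * `|u - v| <= _).
    apply: (@le_trans _ _ (`|C| * enorm (u - v))).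
      by rewrite ler_wpM2r ?enorm_ge0// ler_norm.
    rewrite -mulrA ler_wpM2l//; apply: le_trans (enorm_le_sum _) _.
    apply: (@le_trans _ _ (\sum_(i < m) `|u - v|)).
      apply: ler_sum => i _; rewrite [leRHS]mx_normrE.
      apply: le_trans (le_bigmax _ (fun j : 'I_1 * 'I_m => `|(u - v) j.1 j.2|) (0, i)).
      by [].
    by rewrite sumr_const card_ord -[leLHS]mulr_natl.
  by rewrite lerDl.
by rewrite -ler_pdivlMl.
Qed.

End Euclid.

(** * Gradients, convexity and similarity *)

(** A directional derivative sees only the restriction to a line. This identifies a partial
    derivative in one block with a derivative in the full space, although the two domains differ. *)
Lemma derive_congr (R : realType) (V1 V2 W : normedModType R) (f : V1 -> W)
    (g : V2 -> W) (a v : V1) (b w : V2) :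
  f a = g b -> (forall h : R, f (h *: v + a) = g (h *: w + b)) ->
  'D_v f a = 'D_w g b.
Proof.
move=> fg0 fg; rewrite /derive.
suff -> : (fun h : R => h^-1 *: ((f \o shift a) (h *: v) - f a)) =
          (fun h => h^-1 *: ((g \o shift b) (h *: w) - g b)) by [].
by apply/funext => h; rewrite /= fg0 fg.
Qed.

(** * The saddle operator as a reflected gradient *)

Section Flip.
Variables (R : realType) (dx dy : nat).
Local Notation vec := 'rV[R]_(dx + dy).
Implicit Types (u v z : vec).

(** A self-adjoint isometric involution. By [gradop_flip] it carries [grad f] to the saddle
    operator, so facts about [gradop] reduce to facts about one gradient. *)
Definition flip u : vec := row_mx (lsubmx u) (- rsubmx u).

Lemma flipK : involutive flip.
Proof. by move=> u; rewrite /flip row_mxKl row_mxKr opprK hsubmxK. Qed.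

Lemma flipB u v : flip (u - v) = flip u - flip v.
Proof.
by apply/rowP => i; rewrite !mxE; case: (fintype.split i) => j; rewrite !mxE ?opprD.
Qed.

Lemma flipZ a u : flip (a *: u) = a *: flip u.
Proof. by rewrite /flip !linearZ/= scale_row_mx scalerN. Qed.

Lemma flip0 : flip 0 = 0.
Proof. by have := flipZ 0 0; rewrite !scale0r. Qed.

Lemma flipD u v : flip (u + v) = flip u + flip v.
Proof.
by apply/rowP => i; rewrite !mxE; case: (fintype.split i) => j; rewrite !mxE ?opprD.
Qed.

Lemma flip_sum (I : Type) (r : seq I) (P : pred I) (F : I -> vec) :
  flip (\sum_(i <- r | P i) F i) = \sum_(i <- r | P i) flip (F i).
Proof. by elim/big_rec2 : _ => [|i x y _ <-]; rewrite ?flip0 ?flipD. Qed.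

Lemma dot_split u v :
  dot u v = dot (lsubmx u) (lsubmx v) + dot (rsubmx u) (rsubmx v).
Proof.
by rewrite /dot big_split_ord; congr (_ + _); apply: eq_bigr => i _; rewrite !mxE.
Qed.

Lemma dot_flip u v : dot (flip u) v = dot u (flip v).
Proof.
by rewrite !dot_split /flip !row_mxKl !row_mxKr dotNl dotNr.
Qed.

Lemma enorm_flip u : enorm (flip u) = enorm u.
Proof.
apply/eqP; rewrite -(@eqrXn2 _ 2) ?enorm_ge0//.
by rewrite !enorm_sqr dot_flip flipK.
Qed.

Lemma gradop_flip (f : vec -> R) z : gradop f z = flip (grad f z).
Proof.
rewrite /gradop /flip; congr row_mx.
  apply/rowP => i; rewrite !mxE; apply: derive_congr => [|h]; first by rewrite hsubmxK.
  congr (f _); rewrite -[in RHS](hsubmxK z) -[delta_mx 0 (lshift dy i)]hsubmxK.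
  rewrite scale_row_mx add_row_mx; congr row_mx.
    congr (_ *: _ + _); apply/rowP => j; rewrite !mxE.
    by rewrite (inj_eq (@lshift_inj _ _)).
  rewrite -[LHS]add0r -(scaler0 _ h); congr (_ *: _ + _); apply/rowP => j; rewrite !mxE.
  by rewrite eq_rlshift andbF.
congr (- _); apply/rowP => i; rewrite !mxE; apply: derive_congr => [|h]; first by rewrite hsubmxK.
congr (f _); rewrite -[in RHS](hsubmxK z) -[delta_mx 0 (rshift dx i)]hsubmxK.
rewrite scale_row_mx add_row_mx; congr row_mx.
  rewrite -[LHS]add0r -(scaler0 _ h); congr (_ *: _ + _); apply/rowP => j; rewrite !mxE.
  by rewrite eq_lrshift andbF.
congr (_ *: _ + _); apply/rowP => j; rewrite !mxE.
by rewrite (inj_eq (@rshift_inj _ _)).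
Qed.

End Flip.

Lemma dot_grad (R : realType) m (f : 'rV[R]_m -> R) z h :
  differentiable f z -> dot (grad f z) h = 'D_h f z.
Proof.
move=> fz; rewrite deriveE// [in RHS](row_sum_delta h) linear_sum.
by apply: eq_bigr => i _; rewrite !mxE linearZ deriveE// mulrC.
Qed.

(** First-order optimality along a segment: after division by [t], the term in [B], meant for the
    square of a proximal term, disappears as [t] decreases to 0. *)
Lemma derive_one_sided_ge (R : realType) m (f : 'rV[R]_m -> R) z h (A B : R) :
  derivable f z h ->
  (forall t, 0 < t -> t <= 1 -> 0 <= f (t *: h + z) - f z + t * A + t ^+ 2 * B) ->
  0 <= 'D_h f z + A.
Proof.
move=> fz H.
have c1 : t^-1 *: (f (t *: h + z) - f z) @[t --> 0^'+] --> 'D_h f z.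
  apply: cvg_trans fz; apply: cvg_app => S; 
  apply: (@filterS R (nbhs (0 : R)) _ (fun x => x != 0 -> S x) (fun x => 0 < x -> S x)) => x xS x0.
  by apply: xS; rewrite gt_eqF.
have c2 : (t^-1 *: (f (t *: h + z) - f z) + A + t * B) @[t --> 0^'+] --> 'D_h f z + A + 0 * B.
  apply: cvgD; first by apply: cvgD => //; exact: cvg_cst.
  apply: cvgM; last exact: cvg_cst.
  exact: cvg_at_right_filter.
rewrite mul0r addr0 in c2.
rewrite -(cvg_lim _ c2)//; apply: limr_ge; first by apply/cvg_ex; eexists; exact: c2.
near=> t.
have t0 : 0 < t by [].
have t1 : t <= 1 by near: t; exact: nbhs_right_le.
have := H _ t0 t1; set X := f _ - f z => HX.
rewrite -[_ *: _]/(t^-1 * X).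
have -> : t^-1 * X + A + t * B = t^-1 * (X + t * A + t ^+ 2 * B).
  by field; rewrite gt_eqF.
by rewrite mulr_ge0 ?invr_ge0 ?(ltW t0).
Unshelve. all: by end_near. Qed.

Lemma convex_functionP (R : realType) (E : lmodType R) (f : E -> R) x y (t : R) :
  convex_function setT f -> 0 <= t -> t <= 1 ->
  f (t *: x + (1 - t) *: y) <= t * f x + (1 - t) * f y.
Proof.
move=> cf t0 t1.
by have := cf (Itv01 t0 t1) x y (in_setT _) (in_setT _).
Qed.

Lemma convex_setP (R : realType) (E : lmodType R) (A : set E) x y (t : R) :
  convex_set A -> A x -> A y -> 0 <= t -> t <= 1 -> A (t *: x + (1 - t) *: y).
Proof.
move=> cA Ax Ay t0 t1.
by have := cA x y (Itv01 t0 t1) (mem_set Ax) (mem_set Ay); rewrite inE.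
Qed.

Lemma derive_convex_le (R : realType) m (f : 'rV[R]_m -> R) z h :
  derivable f z h ->
  (forall t, 0 <= t -> t <= 1 -> f (t *: h + z) <= t * f (h + z) + (1 - t) * f z) ->
  'D_h f z <= f (h + z) - f z.
Proof.
move=> fz H; have dN : derivable (- f) z h by apply: derivableN.
have := @derive_one_sided_ge _ _ (- f) z h (f (h + z) - f z) 0 dN.
rewrite deriveN// => K; suff : 0 <= - 'D_h f z + (f (h + z) - f z) by lra.
apply: K => t t0 t1; have := H _ (ltW t0) t1.
rewrite -[(- f) (t *: h + z)]/(- f (t *: h + z)) -[(- f) z]/(- f z).
lra.
Qed.

Section ConvexConcave.
Variables (R : realType) (dx dy : nat).
Local Notation vec := 'rV[R]_(dx + dy).
Implicit Types (f : vec -> R) (u v z : vec).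

(** Sum of the tangent inequality of [f] in the first block and of [- f] in the second one; the two
    values [f z] cancel. This is the bridge from inner products to the gap. *)
Lemma gradop_gap f z z' : differentiable f z -> convex_concave f ->
  f (row_mx (lsubmx z) (rsubmx z')) - f (row_mx (lsubmx z') (rsubmx z))
  <= dot (gradop f z) (z - z').
Proof.
move=> dfz [cx cy]; rewrite gradop_flip dot_flip.
set x := lsubmx z; set y := rsubmx z; set x' := lsubmx z'; set y' := rsubmx z'.
have zE : z = row_mx x y by rewrite hsubmxK.
have -> : flip (z - z') = row_mx 0 (y' - y) - row_mx (x' - x) 0.
  rewrite /flip opp_row_mx add_row_mx !raddfB/= !opprK subr0 add0r.
  by rewrite [- x' + _]addrC [- rsubmx z + _]addrC.
rewrite dotBr !dot_grad//.
have d h : derivable f z h by exact: diff_derivable.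
have h1 : 'D_(row_mx (x' - x) 0) f z <= f (row_mx x' y) - f z.
  have -> : row_mx x' y = row_mx (x' - x) 0 + z.
    by rewrite zE add_row_mx subrK add0r.
  apply: derive_convex_le => // t t0 t1.
  have := convex_functionP x' x (cx y) t0 t1.
  rewrite zE scale_row_mx !add_row_mx scaler0 subrK add0r.
  by congr (f (row_mx _ _) <= _); rewrite scalerBr scalerBl scale1r addrA addrAC.
have h2 : 'D_(row_mx 0 (y' - y)) (- f) z <= - f (row_mx x y') - - f z.
  have -> : row_mx x y' = row_mx 0 (y' - y) + z.
    by rewrite zE add_row_mx subrK add0r.
  apply: derive_convex_le => [|t t0 t1]; first exact: derivableN.
  have := convex_functionP y' y (cy x) t0 t1.
  rewrite zE scale_row_mx !add_row_mx scaler0 !subrK add0r.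
  by congr (- f (row_mx _ _) <= _); rewrite scalerBr scalerBl scale1r addrA addrAC.
rewrite deriveN// in h2; lra.
Qed.

(** The two instances of [gradop_gap], at [z] and at [z'], have opposite left-hand sides. *)
Lemma gradop_monotone f z z' :
  differentiable f z -> differentiable f z' -> convex_concave f ->
  0 <= dot (gradop f z - gradop f z') (z - z').
Proof.
move=> dz dz' cc; have := gradop_gap z' dz cc; have := gradop_gap z dz' cc.
rewrite dotBl -(opprB z z') dotNr.
move: (f (row_mx _ _)) (f (row_mx _ _)) (dot _ _) (dot _ _) => a b c d h1 h2.
lra.
Qed.

End ConvexConcave.

(** The mean value theorem is scalar, so [g] is tested against its own increment [a]; the increment
    of the scalar function [phi] is then exactly [enorm a ^+ 2]. *)
Lemma lipschitz_of_derive (R : realType) m k (g : 'rV[R]_m -> 'rV[R]_k) (C : R)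
    (z1 z2 : 'rV[R]_m) :
  (forall z, differentiable g z) ->
  (forall z v, enorm ('D_v g z) <= C * enorm v) ->
  enorm (g z1 - g z2) <= C * enorm (z1 - z2).
Proof.
move=> dg gC; set a := g z1 - g z2; set v := z1 - z2.
pose phi (t : R) := dot (g (t *: v + z2)) a.
have dphi (t : R) : is_derive t 1 phi (dot ('D_v g (t *: v + z2)) a).
  have c : (h^-1 *: ((phi \o shift t) (h *: 1) - phi t)) @[h --> 0^'] -->
           dot ('D_v g (t *: v + z2)) a.
    have := @diff_derivable _ _ _ g (t *: v + z2) v (dg _); rewrite /derivable => /cvg_ex[l cl].
    have lE : 'D_v g (t *: v + z2) = l by exact: cvg_lim cl.
    rewrite lE.
    have cdot : continuous (fun w => dot w a).
      apply: (@enorm_lipschitz_continuous _ _ _ (enorm a)) => w w'.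
      by rewrite -dotBl mulrC ler_norml dot_le dot_ge.
    rewrite [X in X @ _ --> _](_ : _ =
      (fun w => dot w a) \o (fun h => h^-1 *: ((g \o shift (t *: v + z2)) (h *: v) - g (t *: v + z2)))).
      exact: cvg_comp cl (cdot l).
    apply/funext => h /=.
    rewrite dotZl dotBl /phi; congr (_ * (dot (g _) _ - _)).
    by rewrite -[h%:A]/(h * 1) mulr1 scalerDl addrA.
  by split; [apply/cvg_ex; eexists; exact: c|exact: cvg_lim c].
have cphi : {within `[0, 1], continuous phi}.
  apply: continuous_subspaceT => t; apply: differentiable_continuous.
  by apply/derivable1_diffP; case: (dphi t).
have [c _] := MVT ltr01 (fun t _ => dphi t) cphi.
rewrite /phi scale1r scale0r add0r subrK subr0 mulr1 -dotBl -enorm_sqr => E.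
have a0 := enorm_ge0 a.
have [->|an0] := eqVneq (enorm a) 0; first exact: le_trans (enorm_ge0 _) (gC 0 v).
rewrite -(@ler_pM2r _ (enorm a)) ?lt_def ?an0// -expr2 E.
apply: le_trans (dot_le _ _) _; rewrite ler_wpM2r//.
Qed.

(** * Spectral norm, averages and second-order similarity *)

Section Similarity.
Variables (R : realType).

Lemma specnorm_ge m (A : 'M[R]_m) (v : 'rV[R]_m) :
  enorm (v *m A) <= specnorm A * enorm v.
Proof.
have [/enorm_eq0 ->|v0] := eqVneq (enorm v) 0; first by rewrite mul0mx !enorm0 mulr0.
have vp : 0 < enorm v by rewrite lt_def v0 enorm_ge0.
rewrite -ler_pdivrMr// mulrC -{1}[(enorm v)^-1]ger0_norm ?invr_ge0 ?enorm_ge0//.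
rewrite -enormZ scalemxAl; apply: ub_le_sup; last first.
  exists ((enorm v)^-1 *: v) => //=.
  by rewrite enormZ ger0_norm ?invr_ge0 ?enorm_ge0// mulVf.
(* The supremum defining [specnorm] dominates its elements only if the set is bounded;
   Cauchy-Schwarz on each column gives this bound. *)
exists (\sum_(j < m) enorm (col j A)^T) => _ [w /= w1 <-].
apply: le_trans (enorm_le_sum _) _; apply: ler_sum => j _.
have -> : (w *m A) 0 j = dot w (col j A)^T.
  by rewrite mxE; apply: eq_bigr => i _; rewrite !mxE.
rewrite ler_norml; have := enorm_ge0 (col j A)^T.
have := dot_le w (col j A)^T; have := dot_ge w (col j A)^T.
by have := enorm_ge0 w; nra.
Qed.

Lemma derive_grad_favg dx dy n (f : 'I_n -> 'rV[R]_(dx + dy) -> R) z h :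
  (forall i, differentiable (f i) z) ->
  'D_h (favg f) z = n%:R^-1 * \sum_(i < n) 'D_h (f i) z.
Proof.
move=> df; have -> : favg f = n%:R^-1 *: (\sum_(i < n) f i).
  by apply/funext => w; rewrite /favg /= fct_sumE.
have d i : derivable (f i) z h by exact: diff_derivable.
by rewrite deriveZ ?derive_sum//; exact: derivable_sum.
Qed.

Lemma grad_favg dx dy n (f : 'I_n -> 'rV[R]_(dx + dy) -> R) z :
  (forall i, differentiable (f i) z) ->
  grad (favg f) z = n%:R^-1 *: \sum_(i < n) grad (f i) z.
Proof.
move=> df; apply/rowP => j; rewrite !mxE derive_grad_favg// summxE.
by congr (_ * _); apply: eq_bigr => i _; rewrite mxE.
Qed.

Lemma differentiable_favg dx dy n (f : 'I_n -> 'rV[R]_(dx + dy) -> R) z :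
  (forall i, differentiable (f i) z) -> differentiable (favg f) z.
Proof.
move=> df; have -> : favg f = n%:R^-1 *: (\sum_(i < n) f i).
  by apply/funext => w; rewrite /favg /= fct_sumE.
exact/differentiableZ/differentiable_sum.
Qed.

Lemma gradop_favg dx dy n (f : 'I_n -> 'rV[R]_(dx + dy) -> R) z :
  (forall i, differentiable (f i) z) -> gradop (favg f) z = Favg f z.
Proof.
move=> df; rewrite gradop_flip grad_favg// flipZ flip_sum; congr (_ *: _).
by apply: eq_bigr => i _; rewrite gradop_flip.
Qed.

Lemma convex_concave_favg dx dy n (f : 'I_n -> 'rV[R]_(dx + dy) -> R) :
  (forall i, convex_concave (f i)) -> convex_concave (favg f).
Proof.
move=> cc; split => [y|x] t u v ut vt.
  rewrite /favg convRE !mulr_sumr -big_split/=; apply: ler_sum => i _.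
  have := (cc i).1 y t u v ut vt; rewrite convRE.
  have : 0 <= n%:R^-1 :> R by rewrite invr_ge0.
  set c := n%:R^-1 => c0 h; apply: le_trans (ler_wpM2l c0 h) _.
  by rewrite le_eqVlt; apply/orP; left; apply/eqP; ring.
rewrite /favg convRE !mulrN -!mulNr !mulr_sumr -big_split/=; apply: ler_sum => i _.
have := (cc i).2 x t u v ut vt; rewrite convRE.
have : 0 <= n%:R^-1 :> R by rewrite invr_ge0.
set c := n%:R^-1 => c0 h; have := ler_wpM2l c0 h.
rewrite mulrN mulNr => h'; apply: le_trans h' _.
by rewrite le_eqVlt; apply/orP; left; apply/eqP; ring.
Qed.

(** As [flip] is an isometry, it suffices to treat [grad (f i) - grad (favg f)], whose Jacobian is a
    difference of Hessians. *)
Lemma similar_lipschitz dx dy n (f : 'I_n -> 'rV[R]_(dx + dy) -> R) (delta : R) i z1 z2 :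
  (forall i, twice_differentiable (f i)) -> second_order_similar f delta ->
  enorm ((gradop (f i) z1 - Favg f z1) - (gradop (f i) z2 - Favg f z2))
  <= delta * enorm (z1 - z2).
Proof.
move=> df sim; have dfz z j : differentiable (f j) z by have [] := df j.
rewrite -!gradop_favg// !gradop_flip -!flipB enorm_flip.
have gE : grad (favg f) = n%:R^-1 *: (\sum_(j < n) grad (f j)).
  by apply/funext => w; rewrite grad_favg//= fct_sumE.
have dga z : differentiable (grad (favg f)) z.
  rewrite gE; apply/differentiableZ/differentiable_sum => j.
  by have [_] := df j.
have dgi z : differentiable (grad (f i)) z by have [_] := df i.
apply: (@lipschitz_of_derive _ _ _ (grad (f i) - grad (favg f))) => [z|z v].
  exact: differentiableB.
rewrite deriveB; [|exact: diff_derivable..].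
rewrite !deriveEjacobian// -mulmxBr; apply: le_trans (specnorm_ge _ _) _.
by rewrite ler_wpM2r ?enorm_ge0//; exact: sim.
Qed.

End Similarity.

(** * Projections and the extra-gradient step *)

Lemma ge0_of_linear_perturbation (R : realType) (A B : R) :
  (forall t, 0 < t -> t <= 1 -> 0 <= A + t * B) -> 0 <= A.
Proof.
move=> H; rewrite leNgt; apply/negP => A0.
have B0 : 0 < 1 + `|B| by rewrite ltr_pwDl.
(* Small enough that [t * B] is less than [- A / 2], so that [A + t * B] stays negative. *)
pose t := Num.min 1 (- A / (2 * (1 + `|B|))).
have t0 : 0 < t by rewrite lt_min ltr01/= divr_gt0 ?oppr_gt0// mulr_gt0.
have t1 : t <= 1 by rewrite ge_min lexx.
have tA : t <= - A / (2 * (1 + `|B|)) by rewrite ge_min lexx orbT.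
have := H _ t0 t1; apply/negP; rewrite -ltNge.
have : t * (2 * (1 + `|B|)) <= - A by rewrite -ler_pdivlMr// mulr_gt0.
have : t * B <= t * `|B| by rewrite ler_wpM2l ?ler_norm// ltW.
lra.
Qed.

Local Notation proj := Defs.proj.

Lemma displacement_lipschitz (R : realType) m (phi : 'rV[R]_m -> 'rV[R]_m) :
  (forall u v, enorm (phi u - phi v) <= enorm (u - v)) ->
  forall u v, `|enorm (phi u - u) - enorm (phi v - v)| <= 2 * enorm (u - v).
Proof.
move=> nexp u v; have := nexp u v.
have := enorm_triang (phi u) (phi v) u; have := enorm_triang (phi v) v u.
have := enorm_triang (phi v) (phi u) v; have := enorm_triang (phi u) u v.
rewrite (enormC v u) (enormC (phi v) (phi u)).
move: (enorm (phi u - phi v)) (enorm (phi u - u)) (enorm (phi v - v)) => a b c.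
move: (enorm _) (enorm _) (enorm _) => d e g.
by rewrite ler_norml => *; apply/andP; split; lra.
Qed.

Section Projection.
Variables (R : realType) (dx dy : nat).
Local Notation vec := 'rV[R]_(dx + dy).
Variables (Z : set vec) (D : R).
Implicit Types (u v w q z : vec).
Hypotheses (Z0 : Z !=set0) (cZ : closed Z) (cvZ : convex_set Z).
Hypothesis ZD : forall z1 z2, Z z1 -> Z z2 -> enorm (z1 - z2) <= D.

Lemma compact_of_diam : compact Z.
Proof.
apply: bounded_closed_compact => //; have [q Zq] := Z0.
exists (enorm q + D); split; first exact: num_real.
move=> M hM z Zz; apply: le_trans (ltW hM).
apply: (@le_trans _ _ (enorm z)); last first.
  rewrite -[z in enorm z](subrK q) addrC; apply: le_trans (enormD _ _) _.
  by rewrite lerD2l ZD.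
rewrite [leLHS]mx_normrE; apply/bigmax_leP; split; first exact: enorm_ge0.
by move=> [i j] _ /=; rewrite (ord1 i) enorm_coord.
Qed.

Lemma projP v : is_proj Z v (proj Z v).
Proof.
apply: xgetPex.
have cd : {within Z, continuous (fun w => enorm (v - w))}.
  apply: continuous_subspaceT; apply: (@enorm_lipschitz_continuous _ _ _ 1) => w w'.
  rewrite mul1r ler_norml.
  have := enorm_triang v w w'; have := enorm_triang v w' w.
  by rewrite (enormC w' w); lra.
have [q Zq qmin] := EVT_min_rV Z0 compact_of_diam cd.
exists q; split; first by rewrite -in_setE.
by move=> w Zw; apply: qmin; rewrite in_setE.
Qed.

Lemma proj_in v : Z (proj Z v).
Proof. by have [] := projP v. Qed.

Lemma convex_segment u v (t : R) : Z u -> Z v -> 0 < t -> t <= 1 -> Z (t *: (v - u) + u).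
Proof.
move=> Zu Zv t0 t1; have := convex_setP cvZ Zv Zu (ltW t0) t1.
by congr (Z _); rewrite scalerBr scalerBl scale1r addrA addrAC.
Qed.

(** Obtuse angle property: moving from the projection towards [w] by a small [t] stays in [Z] and
    cannot decrease the distance to [v]. *)
Lemma proj_vi v w : Z w -> 0 <= dot (proj Z v - v) (w - proj Z v).
Proof.
move=> Zw; have [Zq qmin] := projP v; set q := proj Z v in Zq qmin *.
suff : 0 <= 2 * dot (q - v) (w - q) by rewrite pmulr_rge0.
apply: (@ge0_of_linear_perturbation _ _ (enorm (w - q) ^+ 2)) => t t0 t1.
have h : enorm (v - q) <= enorm (v - (t *: (w - q) + q)).
  exact: qmin (convex_segment Zq Zw t0 t1).
have : enorm (v - q) ^+ 2 <= enorm (v - (t *: (w - q) + q)) ^+ 2.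
  by rewrite ler_pXn2r ?nnegrE ?enorm_ge0.
have -> : v - (t *: (w - q) + q) = - ((q - v) + t *: (w - q)).
  by rewrite -opprB -addrA addrC.
rewrite (enormC v q) enormN (enorm_sqrD (q - v)) dotZr enormZ exprMn real_normK ?num_real// => h2.
have : 0 <= t * (2 * dot (q - v) (w - q) + t * enorm (w - q) ^+ 2) by lra.
by rewrite pmulr_rge0.
Qed.

Lemma proj_nonexpansive u v : enorm (proj Z u - proj Z v) <= enorm (u - v).
Proof.
have := proj_vi u (proj_in v); have := proj_vi v (proj_in u).
set p := proj Z u; set q := proj Z v => h1 h2.
have h : enorm (p - q) ^+ 2 <= dot (u - v) (p - q).
  move: h1 h2; rewrite enorm_sqr !(dotBl, dotBr) (dotC q p); lra.
have [->|n0] := eqVneq (enorm (p - q)) 0; first exact: enorm_ge0.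
have pos : 0 < enorm (p - q) by rewrite lt_def n0 enorm_ge0.
by rewrite -(ler_pM2r pos) -expr2 (le_trans h)// dot_le.
Qed.

Lemma proj_fixed_vi q g (tau : R) : 0 < tau -> proj Z (q - tau *: g) = q ->
  forall w, Z w -> 0 <= dot g (w - q).
Proof.
move=> t0 E w Zw; have := proj_vi (q - tau *: g) Zw.
by rewrite E opprB addrC subrK dotZl pmulr_rge0.
Qed.

(** * Variational inequalities for a strongly monotone Lipschitz operator *)

Section Operator.
Variables (G : vec -> vec) (mu l : R).
Hypotheses (mu0 : 0 < mu) (mul : mu <= l).
Hypothesis Gmono : forall u v, mu * enorm (u - v) ^+ 2 <= dot (G u - G v) (u - v).
Hypothesis Glip : forall u v, enorm (G u - G v) <= l * enorm (u - v).

Lemma vi_exists : exists2 q, Z q & forall w, Z w -> 0 <= dot (G q) (w - q).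
Proof.
have l0 : 0 < l by exact: lt_le_trans mul.
(* This step minimizes the squared contraction factor [1 - 2 * tau * mu + tau ^+ 2 * l ^+ 2], with
   value [1 - mu ^+ 2 / l ^+ 2]. *)
have [tau tau0 tauE] : exists2 tau : R, 0 < tau & tau = mu / l ^+ 2.
  by exists (mu / l ^+ 2); rewrite ?divr_gt0 ?exprn_gt0.
pose phi z := proj Z (z - tau *: G z).
have sq u v : enorm (phi u - phi v) ^+ 2 <=
    (1 - mu ^+ 2 / l ^+ 2) * enorm (u - v) ^+ 2.
  have h : enorm (phi u - phi v) ^+ 2 <= enorm ((u - v) - tau *: (G u - G v)) ^+ 2.
    rewrite ler_pXn2r ?nnegrE ?enorm_ge0//; apply: le_trans (proj_nonexpansive _ _) _.
    rewrite le_eqVlt; apply/orP; left; apply/eqP; congr enorm.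
    by rewrite scalerBr !opprD !opprK addrACA.
  apply: le_trans h _; rewrite (enorm_sqrB (u - v) (tau *: _)) dotZr (dotC (u - v)) enormZ ger0_norm ?(ltW tau0)//.
  have h1 : tau * (mu * enorm (u - v) ^+ 2) <= tau * dot (G u - G v) (u - v).
    by rewrite ler_wpM2l ?(ltW tau0).
  have h2 : (tau * enorm (G u - G v)) ^+ 2 <= (tau * (l * enorm (u - v))) ^+ 2.
    apply: lerXn2r; rewrite ?nnegrE ?mulr_ge0 ?enorm_ge0 ?(ltW tau0) ?(ltW l0)//.
    by rewrite ler_wpM2l ?(ltW tau0).
  have -> : (1 - mu ^+ 2 / l ^+ 2) * enorm (u - v) ^+ 2 = enorm (u - v) ^+ 2 -
     2 * (tau * (mu * enorm (u - v) ^+ 2)) + (tau * (l * enorm (u - v))) ^+ 2.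
    by rewrite tauE; field; rewrite gt_eqF.
  by lra.
have contr u v : enorm (u - v) != 0 -> enorm (phi u - phi v) < enorm (u - v).
  move=> n0; have pos : 0 < enorm (u - v) by rewrite lt_def n0 enorm_ge0.
  rewrite -(@ltr_pXn2r _ 2) ?nnegrE ?enorm_ge0//; apply: le_lt_trans (sq u v) _.
  by rewrite gtr_pMl ?exprn_gt0// gtrBl divr_gt0 ?exprn_gt0.
have nexp u v : enorm (phi u - phi v) <= enorm (u - v).
  have [|/contr/ltW//] := eqVneq (enorm (u - v)) 0.
  by move/enorm_eq0/eqP; rewrite subr_eq0 => /eqP ->; rewrite !subrr.
have cont : {within Z, continuous (fun z => enorm (phi z - z))}.
  apply: continuous_subspaceT; apply: (@enorm_lipschitz_continuous _ _ _ 2) => u v.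
  exact: displacement_lipschitz.
have [q Zq qmin] := EVT_min_rV Z0 compact_of_diam cont.
exists q; first by rewrite -in_setE.
apply: (@proj_fixed_vi _ _ tau) => //.
apply/eqP; rewrite -subr_eq0; apply/negPn/negP => n0.
(* If [q] were not fixed, the strict contraction would give [phi q] a smaller displacement than the
   minimal one. *)
have := qmin (phi q); rewrite in_setE => /(_ (proj_in _)); apply/negP.
rewrite -ltNge; apply: contr; apply: contraNN n0 => /eqP/enorm_eq0 h.
by apply/eqP; exact: h.
Qed.

(* Standard analysis of one extra-gradient step [z -> h -> p]: the first
   projection is tested against [p], the second one against the solution [q];
   [tau * l = 1 / 4] absorbs the extrapolation error. *)
Let extragradient_descent q z h p (tau : R) : 0 < tau -> tau * l = 4^-1 ->
  0 <= dot (G q) (h - q) ->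
  0 <= dot (h - (z - tau *: G z)) (p - h) ->
  0 <= dot (p - (z - tau *: G h)) (q - p) ->
  enorm (p - q) ^+ 2 <= (1 - tau * mu) * enorm (z - q) ^+ 2.
Proof.
move=> t0 tl v1 h1 h2.
have E (a b : vec) : a - (z - tau *: b) = (a - z) + tau *: b by rewrite opprB addrA addrAC.
rewrite !E !(dotDl (_ - z)) !dotZl in h1 h2.
have t1 := dot_three_point h z p; have t2 := dot_three_point p z q.
have m1 := Gmono h q; rewrite dotBl in m1.
have l1 : - (enorm (G h - G z) * enorm (p - h)) <= dot (G h - G z) (p - h) by exact: dot_ge.
have l2 := Glip h z.
have par : enorm (z - q) ^+ 2 <= 2 * enorm (z - h) ^+ 2 + 2 * enorm (h - q) ^+ 2.
  by rewrite -[z - q](subrKA h) enormD_sqr.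
have split1 : dot (G h) (q - p) = - dot (G h) (h - q) - dot (G h - G z) (p - h) - dot (G z) (p - h).
  rewrite !(dotBl, dotBr); ring.
rewrite (enormC h z) in t1 l2; rewrite (enormC h p) in t1; rewrite (enormC p z) in t2.
set a := enorm (z - h) in l2 par t1 *; set b := enorm (p - h) in l1 t1 *.
have l3 : tau * (enorm (G h - G z) * b) <= 4^-1 * a * b.
  rewrite -tl -mulrA mulrA [leRHS]mulrA ler_wpM2r ?enorm_ge0// -mulrA.
  by rewrite ler_wpM2l ?(ltW t0).
have tm : tau * mu <= 4^-1 by rewrite -tl ler_wpM2l ?(ltW t0).
have tm0 : 0 <= tau * mu by rewrite mulr_ge0 ?(ltW t0)// ltW.
have m2 : tau * (mu * enorm (h - q) ^+ 2) <= tau * dot (G h) (h - q).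
  by rewrite ler_wpM2l ?(ltW t0)//; lra.
have l4 : tau * - dot (G h - G z) (p - h) <= 4^-1 * a * b.
  by apply: le_trans l3; rewrite ler_wpM2l ?(ltW t0)//; lra.
have par2 : tau * mu * enorm (z - q) ^+ 2 <= tau * mu * (2 * a ^+ 2 + 2 * enorm (h - q) ^+ 2).
  by rewrite ler_wpM2l.
have ab : 2 * (4^-1 * a * b) <= 4^-1 * a ^+ 2 + 4^-1 * b ^+ 2.
  by have := sqr_ge0 (a - b); lra.
have am : tau * mu * (2 * a ^+ 2) <= 4^-1 * (2 * a ^+ 2).
  by rewrite ler_wpM2r// mulr_ge0// sqr_ge0.
have b0 := sqr_ge0 b; have a0 := sqr_ge0 a.
rewrite split1 in h2; rewrite !mulrBr in h2.
move: (dot (G h - G z) _) (dot (G h) _) (dot (G z) _) l4 m2 h1 h2 => X Y W l4 m2 h1 h2.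
lra.
Qed.

Lemma eg_step_contraction q z (tau : R) : 0 < tau -> tau * l = 4^-1 ->
  Z q -> (forall w, Z w -> 0 <= dot (G q) (w - q)) ->
  enorm (eg_step Z G tau z - q) ^+ 2 <= (1 - tau * mu) * enorm (z - q) ^+ 2.
Proof.
move=> t0 tl Zq vi; rewrite /eg_step.
apply: (extragradient_descent (h := proj Z (z - tau *: G z))) => //.
- exact/vi/proj_in.
- exact/proj_vi/proj_in.
- exact: proj_vi.
Qed.

End Operator.
End Projection.

(** * The regularized subproblem *)

Section Subproblem.
Variables (R : realType) (dx dy : nat).
Local Notation vec := 'rV[R]_(dx + dy).
Variables (X : set 'rV[R]_dx) (Y : set 'rV[R]_dy) (f : vec -> R) (eta : R).
Implicit Types (u v w z : vec).
Hypotheses (cvZ : convex_set (prodset X Y)) (eta0 : 0 < eta).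
Hypotheses (df : forall z, differentiable f z) (cc : convex_concave f).

Lemma sub_op_strongly_monotone v u w :
  eta^-1 * enorm (u - w) ^+ 2 <= dot (sub_op f eta v u - sub_op f eta v w) (u - w).
Proof.
have -> : sub_op f eta v u - sub_op f eta v w =
    (gradop f u - gradop f w) + eta^-1 *: (u - w).
  rewrite /sub_op opprD addrACA -scalerBr; congr (_ + _ *: _).
  by rewrite opprB addrA subrK.
rewrite dotDl dotZl enorm_sqr lerDr.
exact: gradop_monotone.
Qed.

Lemma sub_op_lipschitz (L : R) v u w :
  (forall z1 z2, enorm (gradop f z1 - gradop f z2) <= L * enorm (z1 - z2)) ->
  enorm (sub_op f eta v u - sub_op f eta v w) <= (L + eta^-1) * enorm (u - w).
Proof.
move=> fL; have -> : sub_op f eta v u - sub_op f eta v w =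
    (gradop f u - gradop f w) + eta^-1 *: (u - w).
  rewrite /sub_op opprD addrACA -scalerBr; congr (_ + _ *: _).
  by rewrite opprB addrA subrK.
apply: le_trans (enormD _ _) _; rewrite mulrDl lerD// enormZ.
by rewrite ger0_norm// invr_ge0 ltW.
Qed.

(** Testing the inequality with one block frozen separates the minimization from the maximization;
    expanding the proximal square leaves a nonnegative remainder. *)
Lemma sub_vi_saddle v u : prodset X Y u ->
  (forall z, prodset X Y z -> 0 <= dot (sub_op f eta v u) (z - u)) ->
  saddle X Y (sub_obj f eta v) u.
Proof.
move=> Zu vi; have [Xu Yu] := Zu; have e0 : 0 <= (2 * eta)^-1.
  by rewrite invr_ge0 mulr_ge0// ltW.
have eE : eta^-1 = 2 * (2 * eta)^-1 by field; rewrite gt_eqF.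
split => // [x Xx|y Yy].
- have /vi : prodset X Y (row_mx x (rsubmx u)) by rewrite /prodset/= row_mxKl row_mxKr.
  have := gradop_gap (row_mx x (rsubmx u)) (df u) cc.
  rewrite row_mxKl row_mxKr hsubmxK -(opprB (row_mx x _) u) dotNr /sub_op dotDl dotZl.
  rewrite (dot_split (u - v)) !raddfB/= row_mxKl row_mxKr subrr dot0r addr0.
  rewrite /sub_obj row_mxKl row_mxKr.
  have -> : x - lsubmx v = (lsubmx u - lsubmx v) + (x - lsubmx u) by rewrite [RHS]addrC subrKA.
  rewrite (enorm_sqrD (lsubmx u - lsubmx v)) eE; have := mulr_ge0 e0 (sqr_ge0 (enorm (x - lsubmx u))).
  lra.
- have /vi : prodset X Y (row_mx (lsubmx u) y) by rewrite /prodset/= row_mxKl row_mxKr.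
  have := gradop_gap (row_mx (lsubmx u) y) (df u) cc.
  rewrite row_mxKl row_mxKr hsubmxK -(opprB (row_mx _ y) u) dotNr /sub_op dotDl dotZl.
  rewrite (dot_split (u - v)) !raddfB/= row_mxKl row_mxKr subrr dot0r add0r.
  rewrite /sub_obj row_mxKl row_mxKr.
  have -> : y - rsubmx v = (rsubmx u - rsubmx v) + (y - rsubmx u) by rewrite [RHS]addrC subrKA.
  rewrite (enorm_sqrD (rsubmx u - rsubmx v)) eE; have := mulr_ge0 e0 (sqr_ge0 (enorm (y - rsubmx u))).
  lra.
Qed.

(** Each saddle condition is differentiated along a segment moving a single block, which stays in
    [prodset X Y] by convexity; the two first-order conditions add up. *)
Lemma sub_saddle_vi v u : saddle X Y (sub_obj f eta v) u ->
  forall z, prodset X Y z -> 0 <= dot (sub_op f eta v u) (z - u).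
Proof.
move=> [Zu minx maxy] z Zz; have [[Xu Yu] [Xz Yz]] := (Zu, Zz).
have eE : eta^-1 = 2 * (2 * eta)^-1 by field; rewrite gt_eqF.
have d h g : differentiable g u -> derivable g u h by exact: diff_derivable.
have hx : 0 <= 'D_(row_mx (lsubmx z - lsubmx u) 0) f u +
    eta^-1 * dot (lsubmx u - lsubmx v) (lsubmx z - lsubmx u).
  apply: (@derive_one_sided_ge _ _ _ _ _ _ ((2 * eta)^-1 * enorm (lsubmx z - lsubmx u) ^+ 2)).
    exact: d.
  move=> t t0 t1.
  have Zw : prodset X Y (row_mx (lsubmx z) (rsubmx u)) by rewrite /prodset/= row_mxKl row_mxKr.
  have [+ _] := convex_segment cvZ Zu Zw t0 t1.
  rewrite raddfD/= linearZ/= raddfB/= row_mxKl => /minx.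
  rewrite /sub_obj row_mxKl row_mxKr.
  have -> : row_mx (t *: (lsubmx z - lsubmx u) + lsubmx u) (rsubmx u) =
      t *: row_mx (lsubmx z - lsubmx u) 0 + u.
    by rewrite -[X in _ = _ + X]hsubmxK scale_row_mx add_row_mx scaler0 add0r.
  have -> : t *: (lsubmx z - lsubmx u) + lsubmx u - lsubmx v =
     (lsubmx u - lsubmx v) + t *: (lsubmx z - lsubmx u) by rewrite -addrA addrC.
  rewrite (enorm_sqrD (lsubmx u - lsubmx v)) dotZr enormZ exprMn real_normK ?num_real//.
  rewrite eE; lra.
have hy : 0 <= 'D_(row_mx 0 (rsubmx z - rsubmx u)) (- f) u +
    eta^-1 * dot (rsubmx u - rsubmx v) (rsubmx z - rsubmx u).
  apply: (@derive_one_sided_ge _ _ _ _ _ _ ((2 * eta)^-1 * enorm (rsubmx z - rsubmx u) ^+ 2)).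
    by apply: d; exact: differentiableN.
  move=> t t0 t1; rewrite -!/(GRing.opp _ _).
  have Zw : prodset X Y (row_mx (lsubmx u) (rsubmx z)) by rewrite /prodset/= row_mxKl row_mxKr.
  have [_ +] := convex_segment cvZ Zu Zw t0 t1.
  rewrite raddfD/= linearZ/= raddfB/= row_mxKr => /maxy.
  rewrite /sub_obj row_mxKl row_mxKr.
  have -> : row_mx (lsubmx u) (t *: (rsubmx z - rsubmx u) + rsubmx u) =
      t *: row_mx 0 (rsubmx z - rsubmx u) + u.
    by rewrite -[X in _ = _ + X]hsubmxK scale_row_mx add_row_mx scaler0 add0r.
  have -> : t *: (rsubmx z - rsubmx u) + rsubmx u - rsubmx v =
     (rsubmx u - rsubmx v) + t *: (rsubmx z - rsubmx u) by rewrite -addrA addrC.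
  rewrite (enorm_sqrD (rsubmx u - rsubmx v)) dotZr enormZ exprMn real_normK ?num_real//.
  rewrite eE -[(- f) _]/(- f (t *: row_mx 0 (rsubmx z - rsubmx u) + u)) -[(- f) u]/(- f u); lra.
rewrite deriveN in hy; last by exact: d.
rewrite /sub_op dotDl dotZl gradop_flip dot_flip.
have -> : flip (z - u) = row_mx (lsubmx z - lsubmx u) 0 - row_mx 0 (rsubmx z - rsubmx u).
  by rewrite /flip opp_row_mx add_row_mx !raddfB/= oppr0 addr0 add0r.
rewrite dotBr !dot_grad// (dot_split (u - v)) !raddfB/=.
lra.
Qed.

End Subproblem.

(** * Expectation over the draws *)

Section Tuples.
Variables (R : realType) (n : nat).

Lemma sum_tuple_cons (V : nmodType) b (g : b.+1.-tuple 'I_n -> V) :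
  \sum_s g s = \sum_(j < n) \sum_(s : b.-tuple 'I_n) g [tuple of j :: s].
Proof.
rewrite pair_big /= (reindex (fun js : 'I_n * b.-tuple 'I_n => [tuple of js.1 :: js.2])).
  by [].
exists (fun s => (thead s, [tuple of behead s])) => /= [[j s] _|s _].
  by congr pair; apply/val_inj.
by rewrite [RHS]tuple_eta; apply/val_inj.
Qed.

Lemma sum_tuple_centered m (v : 'I_n -> 'rV[R]_m) b : \sum_j v j = 0 ->
  \sum_(s : b.-tuple 'I_n) \sum_(j <- s) v j = 0.
Proof.
move=> v0; elim: b => [|b IH].
  by rewrite big1// => s _; rewrite tuple0 big_nil.
rewrite sum_tuple_cons.
under eq_bigr => j _ do (under eq_bigr => s _ do rewrite big_cons; rewrite big_split/= IH addr0 sumr_const).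
by rewrite sumrMnl v0 mul0rn.
Qed.

(** Variance of a sum of i.i.d. draws, in counting form: by centering, adding a draw creates no
    cross term. The factor [n%:R] on the left avoids the exponent [b - 1]. *)
Lemma sum_tuple_sqr m (v : 'I_n -> 'rV[R]_m) b : \sum_j v j = 0 ->
  n%:R * \sum_(s : b.-tuple 'I_n) enorm (\sum_(j <- s) v j) ^+ 2 =
  b%:R * n%:R ^+ b * \sum_j enorm (v j) ^+ 2.
Proof.
move=> v0; elim: b => [|b IH].
  rewrite mul0r mul0r big1 ?mulr0// => s _.
  by rewrite tuple0 big_nil enorm0 expr0n.
have step j : \sum_(s : b.-tuple 'I_n) enorm (\sum_(i <- [tuple of j :: s]) v i) ^+ 2 =
    n%:R ^+ b * enorm (v j) ^+ 2 + \sum_(s : b.-tuple 'I_n) enorm (\sum_(i <- s) v i) ^+ 2.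
  under eq_bigr => s _ do rewrite big_cons enorm_sqrD.
  rewrite !big_split/= sumr_const card_tuple card_ord -[_ *+ _]mulr_natl natrX.
  by rewrite -mulr_sumr -dot_sumr sum_tuple_centered// dot0r mulr0 addr0.
rewrite sum_tuple_cons (eq_bigr _ (fun j _ => step j)) big_split/= -mulr_sumr sumr_const card_ord.
rewrite -[X in _ * (_ + X)]mulr_natl IH exprS -[b.+1]addn1 natrD.
ring.
Qed.

End Tuples.

Section Expectation.
Variables (R : realType) (n b K : nat) (p : R).
Hypotheses (n0 : (0 < n)%N) (p0 : 0 <= p) (p1 : p <= 1).
Local Notation Omega := (outcome n b K).
Implicit Types (om : Omega) (d : draw n b).

Definition draw_weight d : R := n%:R^-1 ^+ b * (if d.2 then p else 1 - p).

(** Averaging [h (resample om k d)] over [d] is the conditional expectation of [h] given all draws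
    but the [k]-th; measurability becomes invariance under [resample]. *)
Definition resample om (k : 'I_K) d : Omega := [ffun j => if j == k then d else om j].

Lemma resample_eq om k d : resample om k d k = d.
Proof. by rewrite ffunE eqxx. Qed.

Lemma resample_neq om k d j : j != k -> resample om k d j = om j.
Proof. by rewrite ffunE => /negbTE ->. Qed.

Lemma sum_draw_weight (V : lmodType R) (g : draw n b -> V) :
  \sum_d draw_weight d *: g d =
  \sum_(s : b.-tuple 'I_n) n%:R^-1 ^+ b *: (p *: g (s, true) + (1 - p) *: g (s, false)).
Proof.
transitivity (\sum_(s : b.-tuple 'I_n) \sum_(c : bool) draw_weight (s, c) *: g (s, c)).
  by rewrite pair_bigA; apply: eq_bigr => -[].
by apply: eq_bigr => s _; rewrite big_bool /draw_weight/= -!scalerA scalerDr.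
Qed.

Lemma sum_draw_weightR (g : draw n b -> R) :
  \sum_d draw_weight d * g d =
  \sum_(s : b.-tuple 'I_n) n%:R^-1 ^+ b * (p * g (s, true) + (1 - p) * g (s, false)).
Proof. exact: (@sum_draw_weight R^o g). Qed.

Lemma sum_tuple_weight (a : R) : \sum_(s : b.-tuple 'I_n) n%:R^-1 ^+ b * a = a.
Proof.
rewrite sumr_const card_tuple card_ord -[LHS]mulr_natl natrX mulrA -exprMn mulfV ?expr1n ?mul1r//.
by rewrite pnatr_eq0 -lt0n.
Qed.

Lemma draw_weight1 : \sum_d draw_weight d = 1.
Proof.
under eq_bigr do rewrite -[draw_weight _]mulr1.
rewrite (sum_draw_weightR (fun=> 1)) -[RHS](sum_tuple_weight 1).
by apply: eq_bigr => s _; ring.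
Qed.

Lemma draw_weight_ge0 d : 0 <= draw_weight d.
Proof.
by rewrite /draw_weight mulr_ge0 ?exprn_ge0 ?invr_ge0//; case: ifP; rewrite ?subr_ge0.
Qed.

Lemma weightE om : weight p om = \prod_k draw_weight (om k).
Proof. by []. Qed.

Lemma weight_ge0 om : 0 <= weight p om.
Proof. by rewrite weightE prodr_ge0// => k _; exact: draw_weight_ge0. Qed.

Lemma weight_resample om k d :
  weight p om * draw_weight d = weight p (resample om k d) * draw_weight (om k).
Proof.
rewrite !weightE (bigD1 k)//= [in RHS](bigD1 k)//= resample_eq.
rewrite [X in _ = _ * X * _](eq_bigr (fun j => draw_weight (om j))); first by ring.
by move=> j jk; rewrite resample_neq.
Qed.

(** Tower property: exchanging the [k]-th coordinate of [om] with the fresh draw [d] is an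
    involution that preserves the product weight. *)
Lemma Expect_resample (h : Omega -> R) k :
  Expect p h = Expect p (fun om => \sum_d draw_weight d * h (resample om k d)).
Proof.
rewrite /Expect; under [RHS]eq_bigr do rewrite mulr_sumr.
rewrite pair_big/= (reindex (fun x : Omega * draw n b => (resample x.1 k x.2, x.1 k)))/=; last first.
  exists (fun x => (resample x.1 k x.2, x.1 k)) => -[om d] _ /=; congr pair;
    rewrite ?resample_eq//; apply/ffunP => j; rewrite !ffunE; case: eqP => // ->;
    by rewrite ?eqxx.
rewrite -(pair_bigA _ (fun om d => weight p (resample om k d) *
  (draw_weight (om k) * h (resample (resample om k d) k (om k)))))/=.
apply: eq_bigr => om _.
rewrite -[LHS]mulr1 -draw_weight1 mulr_sumr; apply: eq_bigr => d _.
rewrite mulrA -weight_resample.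
have -> : resample (resample om k d) k (om k) = om.
  by apply/ffunP => j; rewrite !ffunE; case: eqP => // ->.
ring.
Qed.

Lemma ExpectD (g h : Omega -> R) :
  Expect p (fun om => g om + h om) = Expect p g + Expect p h.
Proof. by rewrite -big_split; apply: eq_bigr => om _; rewrite mulrDr. Qed.

Lemma ExpectZ (a : R) (g : Omega -> R) :
  Expect p (fun om => a * g om) = a * Expect p g.
Proof. by rewrite mulr_sumr; apply: eq_bigr => om _; rewrite mulrCA. Qed.

Lemma Expect_sum (I : Type) (r : seq I) (P : pred I) (g : I -> Omega -> R) :
  Expect p (fun om => \sum_(i <- r | P i) g i om) = \sum_(i <- r | P i) Expect p (g i).
Proof.
by rewrite exchange_big; apply: eq_bigr => om _; rewrite mulr_sumr.
Qed.

Lemma ler_Expect (g h : Omega -> R) : (forall om, g om <= h om) ->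
  Expect p g <= Expect p h.
Proof. by move=> gh; apply: ler_sum => om _; rewrite ler_wpM2l ?weight_ge0. Qed.

Lemma Expect_cst (a : R) : Expect p (fun _ : Omega => a) = a.
Proof.
rewrite /Expect -mulr_suml; have -> : \sum_(om : Omega) weight p om = 1; last by rewrite mul1r.
transitivity (\prod_(k < K) \sum_d draw_weight d); first by rewrite bigA_distr_bigA.
by rewrite big1// => k _; exact: draw_weight1.
Qed.

Lemma eq_Expect (g h : Omega -> R) : g =1 h -> Expect p g = Expect p h.
Proof. by move=> gh; apply: eq_bigr => om _; rewrite gh. Qed.

Definition indep_of (T : Type) (k : 'I_K) (A : Omega -> T) : Prop :=
  forall om d, A (resample om k d) = A om.

Lemma Expect_dot_centered m k (A xi : Omega -> 'rV[R]_m) : indep_of k A ->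
  (forall om, \sum_d draw_weight d *: xi (resample om k d) = 0) ->
  Expect p (fun om => dot (A om) (xi om)) = 0.
Proof.
move=> Ak xik; rewrite (Expect_resample _ k) -[RHS](Expect_cst 0).
apply: eq_Expect => om; rewrite -[RHS](dot0r (A om)) -(xik om) dot_sumr.
by apply: eq_bigr => d _; rewrite dotZr Ak.
Qed.

(** A cross term vanishes when the later of its two draws is redrawn: the earlier increment does not
    move and the later one averages to zero. *)
Lemma Expect_martingale_sqr m (xi : 'I_K -> Omega -> 'rV[R]_m) :
  (forall j k : 'I_K, (j < k)%N -> indep_of k (xi j)) ->
  (forall k om, \sum_d draw_weight d *: xi k (resample om k d) = 0) ->
  Expect p (fun om => enorm (\sum_k xi k om) ^+ 2) =
  \sum_k Expect p (fun om => enorm (xi k om) ^+ 2).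
Proof.
move=> ad ce.
have E om : enorm (\sum_k xi k om) ^+ 2 = \sum_k \sum_j dot (xi k om) (xi j om).
  by rewrite enorm_sqr dot_suml; apply: eq_bigr => k _; rewrite dot_sumr.
rewrite (eq_Expect E) Expect_sum; apply: eq_bigr => k _.
rewrite Expect_sum (bigD1 k)//= big1 ?addr0.
  by apply: eq_Expect => om; rewrite enorm_sqr.
move=> j jk; have [lt|lt|/val_inj e] := ltngtP j k.
- rewrite -[RHS](@Expect_dot_centered _ k (xi j) (xi k)); [|exact: ad|exact: ce].
  by apply: eq_Expect => om; rewrite dotC.
- by apply: (@Expect_dot_centered _ j); [exact: ad|exact: ce].
- by rewrite e eqxx in jk.
Qed.

End Expectation.

(** * Descent and expected gap *)

Section Step.
Variables (R : realType) (m : nat).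
Implicit Types (u z : 'rV[R]_m).

(* [xi] is the error of the gradient estimator, which targets the optimistic
   extrapolation [G zk + (G zk - G zp)] of [G uh]. *)
Lemma svogs_step (F1 G : 'rV[R]_m -> 'rV[R]_m) (L delta eta gamma D : R)
    (zk wk zp uh u z xi : 'rV[R]_m) :
  0 < eta -> 0 <= delta ->
  enorm ((F1 u + G u) - (F1 uh + G uh)) <= L * enorm (u - uh) ->
  (forall x y, enorm (G x - G y) <= delta * enorm (x - y)) ->
  0 <= dot (F1 uh + eta^-1 *: (uh - ((1 - gamma) *: zk + gamma *: wk
              - eta *: (xi + (G zk + (G zk - G zp)))))) (z - uh) ->
  enorm (uh - z) <= D ->
  dot (F1 u + G u) (u - z) <=
    dot (G u - G zk) (u - z) - dot (G zk - G zp) (zk - z)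
    + delta * enorm (zk - zp) * enorm (uh - zk)
    + enorm xi * enorm (uh - zk) - dot xi (zk - z)
    + (2 * eta)^-1 * ((1 - gamma) * (enorm (zk - z) ^+ 2 - enorm (uh - zk) ^+ 2)
        + gamma * (enorm (wk - z) ^+ 2 - enorm (uh - wk) ^+ 2) - enorm (u - z) ^+ 2)
    + enorm (u - uh) * (enorm (F1 u + G u) + L * D + delta * D
                        + delta * enorm (u - zk) + D / eta)
    + (2 * eta)^-1 * enorm (u - uh) ^+ 2.
Proof.
move=> eta0 d0 FL GL vi hD.
have D0 : 0 <= D := le_trans (enorm_ge0 _) hD.
have e2 : 0 <= (2 * eta)^-1 by rewrite invr_ge0 mulr_ge0// ltW.
have t1 := dot_three_point uh zk z; have t2 := dot_three_point uh wk z.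
(* [c1] to [c4] and [c7] pass from the exact point [uh] to [u] at a price vanishing with
   [enorm (u - uh)]; [c5] and [c6] bound the extrapolation and estimation errors. *)
have c1 : dot (F1 u + G u) (u - uh) <= enorm (u - uh) * enorm (F1 u + G u).
  by rewrite mulrC dot_le.
have c2 : dot ((F1 u + G u) - (F1 uh + G uh)) (uh - z) <= enorm (u - uh) * (L * D).
  apply: le_trans (dot_le _ _) _; rewrite mulrCA mulrA.
  by apply: ler_pM => //; exact: enorm_ge0.
have c3 : - dot (G u - G uh) (uh - z) <= enorm (u - uh) * (delta * D).
  rewrite -dotNl; apply: le_trans (dot_le _ _) _; rewrite mulrCA mulrA enormN.
  by apply: ler_pM => //; exact: enorm_ge0.
have c4 : - dot (G u - G zk) (u - uh) <= enorm (u - uh) * (delta * enorm (u - zk)).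
  rewrite -dotNl; apply: le_trans (dot_le _ _) _; rewrite mulrC enormN.
  by rewrite ler_wpM2l ?enorm_ge0.
have c5 : - dot (G zk - G zp) (uh - zk) <= delta * enorm (zk - zp) * enorm (uh - zk).
  rewrite -dotNl; apply: le_trans (dot_le _ _) _; rewrite enormN.
  by rewrite ler_wpM2r ?enorm_ge0.
have c6 : - dot xi (uh - zk) <= enorm xi * enorm (uh - zk).
  by rewrite -dotNl; apply: le_trans (dot_le _ _) _; rewrite enormN.
have c7 : enorm (u - z) ^+ 2 <= enorm (uh - z) ^+ 2 + 2 * (enorm (u - uh) * D) + enorm (u - uh) ^+ 2.
  have : enorm (u - z) ^+ 2 <= (enorm (u - uh) + enorm (uh - z)) ^+ 2.
    by rewrite lerXn2r ?nnegrE ?addr_ge0 ?enorm_ge0// enorm_triang.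
  have : enorm (u - uh) * enorm (uh - z) <= enorm (u - uh) * D.
    by rewrite ler_wpM2l ?enorm_ge0.
  lra.
have c8 := ler_wpM2l e2 c7.
have viE : dot (F1 uh + eta^-1 *: (uh - ((1 - gamma) *: zk + gamma *: wk
              - eta *: (xi + (G zk + (G zk - G zp)))))) (z - uh) =
   dot (F1 uh) (z - uh) + dot (xi + (G zk + (G zk - G zp))) (z - uh)
   + (2 * eta)^-1 * ((1 - gamma) * (2 * dot (uh - zk) (z - uh)) + gamma * (2 * dot (uh - wk) (z - uh))).
  rewrite dotDl dotZl !(dotBl uh) (dotBl (_ + _) (eta *: _)) (dotDl ((1 - gamma) *: zk)) !dotZl.
  by field; rewrite gt_eqF.
rewrite viE t1 t2 in vi.
have eE : D / eta = (2 * eta)^-1 * (2 * D) by field; rewrite gt_eqF.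
rewrite eE.
rewrite !(dotBl, dotBr, dotDl, dotDr) in c1 c2 c3 c4 c5 c6 vi *.
clear -c1 c2 c3 c4 c5 c6 c8 vi.
set N1 := enorm (F1 u + G u) in c1 *.
move: (enorm (u - uh)) (enorm (uh - z)) (enorm (u - z)) (enorm (uh - zk)) (enorm (uh - wk))
  (enorm (zk - z)) (enorm (wk - z)) (enorm (zk - zp)) (enorm (u - zk)) (enorm xi) (2 * eta)^-1 N1
  c1 c2 c3 c4 c5 c6 c8 vi => n1 n2 n3 n4 n5 n6 n7 n8 n9 n10 et n11 c1 c2 c3 c4 c5 c6 c8 vi.
lra.
Qed.

End Step.

(** Charges a quantity of step [k.+1] to the negative terms of step [k]; nothing is due at step 0,
    and the last [h] is dropped by its sign. *)
Lemma ler_sum_shift (R : realDomainType) (K : nat) (g h : nat -> R) :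
  g 0%N = 0 -> (forall k, 0 <= h k) -> (forall k, (k < K)%N -> g k.+1 <= h k) ->
  \sum_(k < K) g k <= \sum_(k < K) h k.
Proof.
move=> g0 h0 gh; case: K gh => [|K] gh; first by rewrite !big_ord0.
rewrite big_ord_recl big_ord_recr/= g0 add0r -[leLHS]addr0 lerD//.
by apply: ler_sum => k _; apply: gh; rewrite ltnS ltnW.
Qed.

Lemma sum_telescope_split (R : realDomainType) (K : nat) (P : nat -> R) (c x y : 'I_K -> R) (s : R) :
  \sum_(k < K) (P k - P k.+1 + c k + x k - s * y k) =
  P 0%N - P K + \sum_k c k + \sum_k x k - s * \sum_k y k.
Proof.
rewrite sumrB !big_split/= -mulr_sumr sumrN.
have := telescope_sumr P (leq0n K); rewrite big_mkord sumrB => h.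
lra.
Qed.

Lemma enorm_mean_le (R : realType) m n (v : 'I_n -> 'rV[R]_m) (c : R) : (0 < n)%N ->
  (forall i, enorm (v i) <= c) -> enorm (n%:R^-1 *: \sum_i v i) <= c.
Proof.
move=> n0 vc; rewrite enormZ ger0_norm ?invr_ge0// ler_pdivrMl ?ltr0n//.
apply: le_trans (enorm_sum _ _ _) _.
apply: (@le_trans _ _ (\sum_(i < n) c)); first by apply: ler_sum => i _.
by rewrite sumr_const card_ord mulr_natl.
Qed.

(** Jensen through a subgradient at the mean: the linear terms cancel in the sum. *)
Lemma jensen_gradient (R : realType) (m K : nat) (g : 'rV[R]_m -> R) (h : 'rV[R]_m -> 'rV[R]_m)
    (u : 'I_K -> 'rV[R]_m) : (0 < K)%N ->
  (forall x x', g x - g x' <= dot (h x) (x - x')) ->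
  K%:R * g (K%:R^-1 *: \sum_k u k) <= \sum_k g (u k).
Proof.
move=> K0 gh; set ub := _ *: _.
have : \sum_k (g ub - g (u k)) <= \sum_k dot (h ub) (ub - u k) by apply: ler_sum => k _.
rewrite -dot_sumr !sumrB !sumr_const card_ord.
have -> : ub *+ K - \sum_k u k = 0.
  rewrite -scaler_nat scalerA mulfV ?scale1r ?subrr// pnatr_eq0 -lt0n//.
by rewrite dot0r subr_le0 mulr_natl.
Qed.

(** Jensen is applied in each block with the other one frozen at the comparator; as [B] serves all
    comparators at once, the supremum and the infimum can be taken last. *)
Lemma Gap_mean_le (R : realType) (dx dy K : nat) (X : set 'rV[R]_dx) (Y : set 'rV[R]_dy)
    (phi : 'rV[R]_(dx + dy) -> R) (u : 'I_K -> 'rV[R]_(dx + dy)) (B : R) :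
  (0 < K)%N -> prodset X Y !=set0 ->
  (forall z, differentiable phi z) -> convex_concave phi ->
  (forall z, prodset X Y z -> \sum_k dot (gradop phi (u k)) (u k - z) <= B) ->
  Gap X Y phi (K%:R^-1 *: \sum_k u k) <= K%:R^-1 * B.
Proof.
move=> K0 [zz [Xz Yz]] dphi cc H; set ub := _ *: _.
have Kp : 0 < K%:R :> R by rewrite ltr0n.
have lub : lsubmx ub = K%:R^-1 *: \sum_k lsubmx (u k) by rewrite /ub linearZ/= raddf_sum.
have rub : rsubmx ub = K%:R^-1 *: \sum_k rsubmx (u k) by rewrite /ub linearZ/= raddf_sum.
have key x y : X x -> Y y ->
    phi (row_mx (lsubmx ub) y) <= K%:R^-1 * B + phi (row_mx x (rsubmx ub)).
  move=> Xx Yy.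
  have Jx : K%:R * phi (row_mx (lsubmx ub) y) <= \sum_k phi (row_mx (lsubmx (u k)) y).
    rewrite lub; apply: (@jensen_gradient _ _ _ (fun x => phi (row_mx x y))
      (fun x => lsubmx (gradop phi (row_mx x y)))) => // x1 x2.
    have := gradop_gap (row_mx x2 y) (dphi (row_mx x1 y)) cc.
    rewrite !row_mxKl !row_mxKr dot_split !raddfB/= !row_mxKl !row_mxKr subrr dot0r addr0.
    by [].
  have Jy : K%:R * - phi (row_mx x (rsubmx ub)) <= \sum_k - phi (row_mx x (rsubmx (u k))).
    rewrite rub; apply: (@jensen_gradient _ _ _ (fun y => - phi (row_mx x y))
      (fun y => rsubmx (gradop phi (row_mx x y)))) => // y1 y2.
    have := gradop_gap (row_mx x y2) (dphi (row_mx x y1)) cc.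
    rewrite !row_mxKl !row_mxKr dot_split !raddfB/= !row_mxKl !row_mxKr subrr dot0r add0r row_mxKl.
    by lra.
  have Hxy := H (row_mx x y); rewrite /prodset/= row_mxKl row_mxKr in Hxy.
  have {}Hxy := Hxy (conj Xx Yy).
  have S : \sum_k (phi (row_mx (lsubmx (u k)) y) + - phi (row_mx x (rsubmx (u k)))) <= B.
    apply: le_trans Hxy; apply: ler_sum => k _.
    have := gradop_gap (row_mx x y) (dphi (u k)) cc.
    by rewrite !row_mxKl !row_mxKr.
  rewrite big_split/= in S; rewrite -lerBlDr ler_pdivlMl//; lra.
rewrite /Gap lerBlDr; apply: ge_sup; first by exists (phi (row_mx (lsubmx ub) (rsubmx zz))), (rsubmx zz).
move=> _ [y Yy <-]; rewrite -lerBlDl; apply: lb_le_inf.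
  by exists (phi (row_mx (lsubmx zz) (rsubmx ub))), (lsubmx zz).
by move=> _ [x Xx <-]; rewrite lerBlDl; exact: key.
Qed.

(** * Regret of a run for each outcome, and its expectation *)

Section Descent.
Variables (R : realType) (dx dy n b K : nat).
Local Notation vec := 'rV[R]_(dx + dy).
Local Notation Omega := (outcome n b K).
Variables (X : set 'rV[R]_dx) (Y : set 'rV[R]_dy).
Variables (f : 'I_n -> vec -> R) (i1 : 'I_n) (eta gamma delta L D M epsilon zeta : R).
Variables (z0 : vec) (eps : nat -> Omega -> R) (tr : trace R (dx + dy) n b K).
Local Notation Z := (prodset X Y).
Local Notation z_ k om := (zs tr k om).
Local Notation w_ k om := (ws tr k om).
Local Notation uh_ k om := (uhats tr k om).
Local Notation F := (Favg f).

Hypotheses (n0 : (0 < n)%N) (b0 : (0 < b)%N).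
Hypotheses (gamma0 : 0 < gamma) (gamma1 : gamma <= 9^-1) (gammab : 1 <= 9 * gamma * b%:R).
Hypotheses (delta0 : 0 < delta) (deltaL : delta <= L) (etaE : eta = (32 * delta)^-1).
Hypotheses (cvZ : convex_set Z) (Zz0 : Z z0).
Hypothesis ZD : forall z1 z2, Z z1 -> Z z2 -> enorm (z1 - z2) <= D.
Hypotheses (df : forall i z, differentiable (f i) z) (cc : forall i, convex_concave (f i)).
Hypothesis fL : smooth f L.
Hypothesis sim : forall i z1 z2,
  enorm ((gradop (f i) z1 - F z1) - (gradop (f i) z2 - F z2)) <= delta * enorm (z1 - z2).
Hypothesis fM : forall i, enorm (gradop (f i) z0) <= M.
Hypothesis run : svogs_run X Y f i1 eta gamma 1 z0 eps tr.
Hypothesis eps_zeta : forall k om, eps k om <= zeta.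
Hypothesis eps_res : forall k om, eps k om <= 100^-1 * enorm (uh_ k om - z_ k om) ^+ 2.
Hypothesis zeta_eps : forall t : R, 0 <= t -> t ^+ 2 <= zeta ->
  t * (M + 5 * (L * D) + D / eta) <= epsilon / 4.

Let G (x : vec) : vec := F x - gradop (f i1) x.
Let H (i : 'I_n) (x : vec) : vec := gradop (f i) x - F x.
Let xi (k : 'I_K) (om : Omega) : vec :=
  delta_est f i1 1 tr k om - (G (z_ k om) + (G (z_ k om) - G (z_ k.-1 om))).
Let q (k : 'I_K) (om : Omega) : vec :=
  w_ k.+1 om - (gamma *: z_ k.+1 om + (1 - gamma) *: w_ k om).
Let r k om := enorm (uh_ k om - z_ k om).
Let a k om := enorm (uh_ k om - w_ k om).
Let e k om := enorm (z_ k.+1 om - uh_ k om).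

Let L0 : 0 < L := lt_le_trans delta0 deltaL.

Let D0 : 0 <= D.
Proof. exact: le_trans (enorm_ge0 _) (ZD Zz0 Zz0). Qed.

Let M0 : 0 <= M.
Proof. exact: le_trans (enorm_ge0 _) (fM i1). Qed.

Let nE : n%:R * n%:R^-1 = 1 :> R.
Proof. by rewrite mulfV// pnatr_eq0 -lt0n. Qed.

Let bE : b%:R * b%:R^-1 = 1 :> R.
Proof. by rewrite mulfV// pnatr_eq0 -lt0n. Qed.

Let G_lipschitz x y : enorm (G x - G y) <= delta * enorm (x - y).
Proof.
apply: le_trans (sim i1 x y); rewrite -enormN le_eqVlt; apply/orP; left; apply/eqP.
by congr enorm; rewrite /G opprB !opprB addrC.
Qed.

Let F_lipschitz x y : enorm (F x - F y) <= L * enorm (x - y).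
Proof.
by rewrite /Favg -scalerBr -sumrB; apply: enorm_mean_le => // i; exact: fL.
Qed.

Let F_z0 : enorm (F z0) <= M.
Proof. exact: enorm_mean_le. Qed.

Let uh_in (k : 'I_K) om : Z (uh_ k om).
Proof. by have [] := run_uhat run k om. Qed.

Let e_sqr (k : 'I_K) om : e k om ^+ 2 <= eps k om.
Proof. by rewrite /e (run_z run); exact: (run_u run). Qed.

Let e_le_r (k : 'I_K) om : e k om <= 10^-1 * r k om.
Proof.
rewrite -(@ler_pXn2r _ 2) ?nnegrE ?mulr_ge0 ?enorm_ge0//.
apply: le_trans (e_sqr k om) (le_trans (eps_res k om) _).
by rewrite exprMn exprVn -natrX.
Qed.

(** Inexact iterates may leave [Z], but the radius reproduces itself:
    [D + (D + 5 / 4 * D) / 10 <= 5 / 4 * D]. *)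
Let z_dist k om z : (k <= K)%N -> Z z -> enorm (z_ k om - z) <= 5 / 4 * D.
Proof.
move=> kK Zz; elim: k kK => [|k IH] kK.
  by rewrite (run_z0 run); apply: le_trans (ZD Zz0 Zz) _; have := D0; lra.
have {}IH := IH (ltnW kK).
have h1 := ZD (uh_in (Ordinal kK) om) Zz.
have h2 := e_le_r (Ordinal kK) om; rewrite /e /r /= in h1 h2.
have h3 := enorm_triang (uh_ k om) z (z_ k om); rewrite (enormC z) in h3.
have h4 := enorm_triang (z_ k.+1 om) (uh_ k om) z.
have h5 := D0; lra.
Qed.

Let r_le (k : 'I_K) om : r k om <= 5 / 4 * D.
Proof. by rewrite /r enormC; apply: z_dist => //; exact: ltnW. Qed.

Let step_len (k : 'I_K) om : enorm (z_ k.+1 om - z_ k om) <= 11 / 10 * r k om.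
Proof.
apply: le_trans (enorm_triang _ (uh_ k om) _) _.
have := e_le_r k om; rewrite /e /r; lra.
Qed.

Let eta0 : 0 < eta.
Proof. by rewrite etaE invr_gt0 mulr_gt0. Qed.

Let eta2E : (2 * eta)^-1 = 16 * delta.
Proof. by rewrite etaE; field; rewrite gt_eqF. Qed.

(** By [z_dist] the gradient is at most [M + 5 / 4 * (L * D)]; with [delta <= L] the multiples of
    [L * D] add up to 5/4 + 1 + 1 + 11/8, less than 5. *)
Let inexact_le (k : 'I_K) om :
  e k om * (enorm (F (z_ k.+1 om)) + L * D + delta * D
            + delta * enorm (z_ k.+1 om - z_ k om) + D / eta) <= epsilon / 4.
Proof.
have e0 : 0 <= e k om by exact: enorm_ge0.
apply: le_trans (zeta_eps e0 (le_trans (e_sqr k om) (eps_zeta k om))).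
rewrite ler_wpM2l// lerD2r.
have h1 : enorm (F (z_ k.+1 om)) <= M + L * (5 / 4 * D).
  rewrite -[F _](subrK (F z0)) addrC; apply: le_trans (enormD _ _) _.
  rewrite lerD// ?F_z0//; apply: le_trans (F_lipschitz _ _) _.
  by rewrite ler_wpM2l ?(ltW L0)//; exact: z_dist.
have h2 : delta * enorm (z_ k.+1 om - z_ k om) <= L * (11 / 8 * D).
  apply: ler_pM => //; rewrite ?enorm_ge0 ?(ltW delta0)//.
  by apply: le_trans (step_len k om) _; have := r_le k om; lra.
have h3 : delta * D <= L * D by rewrite ler_wpM2r.
have h4 : 0 <= L * D by rewrite mulr_ge0 ?(ltW L0).
lra.
Qed.

Let T k om z := dot (G (z_ k om) - G (z_ k.-1 om)) (z_ k om - z).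
(** Mean over the refresh coin of the squared distance from w^(k+1) to z^0, minus its actual
    value. *)
Let noise k om := gamma * enorm (z_ k.+1 om - z0) ^+ 2
  + (1 - gamma) * enorm (w_ k om - z0) ^+ 2 - enorm (w_ k.+1 om - z0) ^+ 2.
(** Potential of the descent. The term [T] carries the extrapolation correction, whose new value at
    each step is cancelled by the next one. *)
Let Psi z k om := 16 * delta * ((1 - gamma) * enorm (z_ k om - z) ^+ 2
  + enorm (w_ k om - z) ^+ 2) - T k om z.
Let cost (k : 'I_K) om := epsilon / 4
  + delta * enorm (z_ k om - z_ k.-1 om) * r k om + enorm (xi k om) * r k om
  - dot (z_ k om - z0) (xi k om)
  - 16 * delta * ((1 - gamma) * r k om ^+ 2 + gamma * a k om ^+ 2)
  - 16 * delta * noise k om + 16 * delta * e k om ^+ 2.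

(** The weights [gamma], [1 - gamma] and [- 1] sum to zero, so the square of [z - z0] cancels and
    the dependence on [z] is affine. *)
Let noise_shift (k : 'I_K) om z :
  gamma * enorm (z_ k.+1 om - z) ^+ 2 + (1 - gamma) * enorm (w_ k om - z) ^+ 2
    - enorm (w_ k.+1 om - z) ^+ 2
  = noise k om + 2 * dot (q k om) (z - z0).
Proof.
have S v : enorm (v - z) ^+ 2 = enorm (v - z0) ^+ 2 - 2 * dot (v - z0) (z - z0) + enorm (z - z0) ^+ 2.
  by rewrite -enorm_sqrB opprB addrA subrK.
rewrite /noise !S /q !(dotBl _ _ (z - z0)) dotDl !dotZl; ring.
Qed.

Let step_le (k : 'I_K) om z : Z z ->
  dot (F (z_ k.+1 om)) (z_ k.+1 om - z) <=
  Psi z k om - Psi z k.+1 om + cost k om + dot (xi k om) (z - z0)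
  - 32 * delta * dot (q k om) (z - z0).
Proof.
move=> Zz.
have FE x : F x = gradop (f i1) x + G x by rewrite /G addrC subrK.
have vi := sub_saddle_vi cvZ eta0 (df i1) (run_uhat run k om) Zz.
have dE : delta_est f i1 1 tr k om =
    xi k om + (G (z_ k om) + (G (z_ k om) - G (z_ k.-1 om))) by rewrite /xi subrK.
rewrite /sub_op /vvec /zbar dE in vi.
have := @svogs_step _ _ (gradop (f i1)) G L delta eta gamma D (z_ k om) (w_ k om)
  (z_ k.-1 om) (uh_ k om) (z_ k.+1 om) z (xi k om) eta0 (ltW delta0) _ G_lipschitz vi
  (ZD (uh_in k om) Zz).
rewrite -!FE => /(_ (F_lipschitz _ _)) => h.
have h1 := inexact_le k om; have h2 := noise_shift k om z.
(* The first part has mean zero because [z_ k om - z0] precedes the draw [k]; the second one is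
   linear in [z - z0], hence summable over [k] before the choice of [z]. *)
have h3 : dot (xi k om) (z_ k om - z) =
   dot (z_ k om - z0) (xi k om) - dot (xi k om) (z - z0).
  by rewrite (dotC _ (xi k om)) -dotBr opprB addrA subrK.
rewrite h3 eta2E in h; apply: le_trans h _.
rewrite /cost /Psi /T /= -/(r k om) -/(a k om) -/(e k om).
move: (enorm (z_ k.+1 om - z) ^+ 2) (enorm (w_ k.+1 om - z) ^+ 2) h2 => A B h2.
have {}h2 : 16 * delta * (gamma * A + (1 - gamma) * enorm (w_ k om - z) ^+ 2 - B) =
  16 * delta * (noise k om + 2 * dot (q k om) (z - z0)) by rewrite h2.
lra.
Qed.

Let X_ k om := enorm (z_ k om - z_ k.-1 om).

Let bound om := 164 * (delta * D ^+ 2) + \sum_(k < K) cost k om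
  + (8 * delta)^-1 * enorm (\sum_(k < K) xi k om) ^+ 2
  + 2 * delta * enorm (\sum_(k < K) q k om) ^+ 2.

(** The constant 164 is 32 for the initial potential, 2 for the final one, and 2 and 128 from
    Young's inequality on the sums of [xi] and of [q]. *)
Let regret_le om z : (0 < K)%N -> Z z ->
  \sum_(k < K) dot (F (z_ k.+1 om)) (z_ k.+1 om - z) <= bound om.
Proof.
move=> K0 Zz; apply: le_trans (ler_sum _ (fun k _ => step_le k om Zz)) _.
rewrite (sum_telescope_split (fun k => Psi z k om)) -!dot_suml.
set S := \sum_(k < K) xi k om; set Q := \sum_(k < K) q k om.
have zD : enorm (z - z0) <= D by exact: ZD.
have z0D : enorm (z0 - z) ^+ 2 <= D ^+ 2 by rewrite lerXn2r ?nnegrE ?enorm_ge0// ZD.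
have P0 : Psi z 0%N om <= 32 * (delta * D ^+ 2).
  rewrite /Psi /T /= (run_z0 run) (run_w0 run) subrr dot0l subr0.
  have d2 : 0 <= delta * enorm (z0 - z) ^+ 2 by rewrite mulr_ge0 ?sqr_ge0 ?(ltW delta0).
  have d3 : delta * enorm (z0 - z) ^+ 2 <= delta * D ^+ 2 by rewrite ler_wpM2l ?(ltW delta0).
  have d4 : 0 <= gamma * (delta * enorm (z0 - z) ^+ 2) by rewrite mulr_ge0 ?(ltW gamma0).
  lra.
have PK : - Psi z K om <= 2 * (delta * D ^+ 2).
  have TK : T K om z <= delta * (11 / 8 * D) * (5 / 4 * D).
    apply: le_trans (dot_le _ _) _; apply: ler_pM; rewrite ?enorm_ge0 ?z_dist//.
    apply: le_trans (G_lipschitz _ _) _; rewrite ler_wpM2l ?(ltW delta0)//.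
    have Kp : (K.-1 < K)%N by rewrite prednK.
    have := step_len (Ordinal Kp) om; rewrite /= (prednK K0) => h.
    by apply: le_trans h _; have := r_le (Ordinal Kp) om; rewrite /=; lra.
  have g1 : 0 <= 1 - gamma by have := gamma1; lra.
  have d2 : 0 <= 16 * delta * ((1 - gamma) * enorm (z_ K om - z) ^+ 2 + enorm (w_ K om - z) ^+ 2).
    apply: mulr_ge0; first by have := delta0; lra.
    by apply: addr_ge0; rewrite ?sqr_ge0// mulr_ge0 ?sqr_ge0.
  have d3 : 0 <= delta * D ^+ 2 by rewrite mulr_ge0 ?sqr_ge0 ?(ltW delta0).
  rewrite /Psi; lra.
have HS : dot S (z - z0) <= 2 * (delta * D ^+ 2) + (8 * delta)^-1 * enorm S ^+ 2.
  apply: (@le_trans _ _ (enorm S * D)).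
    by apply: le_trans (dot_le _ _) _; rewrite ler_wpM2l ?enorm_ge0.
  have : 0 <= (8 * delta)^-1 * (enorm S - 4 * delta * D) ^+ 2.
    apply: mulr_ge0; last exact: sqr_ge0.
    by rewrite invr_ge0; have := delta0; lra.
  have -> : (8 * delta)^-1 * (enorm S - 4 * delta * D) ^+ 2 =
    (8 * delta)^-1 * enorm S ^+ 2 - enorm S * D + 2 * (delta * D ^+ 2).
    by field; rewrite gt_eqF.
  lra.
have HQ : - (32 * delta * dot Q (z - z0)) <= 128 * (delta * D ^+ 2) + 2 * delta * enorm Q ^+ 2.
  have h1 : - dot Q (z - z0) <= enorm Q * D.
    rewrite -dotNl; apply: le_trans (dot_le _ _) _; rewrite enormN.
    by rewrite ler_wpM2l ?enorm_ge0.
  have h2 : delta * - dot Q (z - z0) <= delta * (enorm Q * D).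
    by rewrite ler_wpM2l ?(ltW delta0).
  have : 0 <= delta * (enorm Q - 8 * D) ^+ 2 by rewrite mulr_ge0 ?sqr_ge0 ?(ltW delta0).
  lra.
rewrite /bound -/S -/Q; lra.
Qed.

Let z_indep (k : 'I_K) om d j : (j <= k)%N -> z_ j (resample om k d) = z_ j om.
Proof.
case: j => [_|j jk]; first by rewrite !(run_z0 run).
have jK : (j < K)%N := ltn_trans jk (ltn_ord k).
rewrite !(run_z run (Ordinal jK)); apply: (run_u_adapted run).
  move=> i /= ij; rewrite resample_neq// -val_eqE/= neq_ltn.
  by rewrite (ltn_trans ij jk).
by rewrite resample_neq// -val_eqE/= neq_ltn jk.
Qed.

Let w_indep (k : 'I_K) om d j : (j <= k)%N -> w_ j (resample om k d) = w_ j om.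
Proof.
elim: j => [_|j IH jk]; first by rewrite !(run_w0 run).
have jK : (j < K)%N := ltn_trans jk (ltn_ord k).
rewrite !(run_w run (Ordinal jK)) resample_neq; last by rewrite -val_eqE/= neq_ltn jk.
by rewrite z_indep// IH// ltnW.
Qed.

(** The point u^k is fixed once the batch is revealed and before the coin is tossed; this is what
    centers the refresh of w. *)
Let z_coin (k : 'I_K) om s c c' :
  z_ k.+1 (resample om k (s, c)) = z_ k.+1 (resample om k (s, c')).
Proof.
rewrite !(run_z run); apply: (run_u_adapted run); last by rewrite !resample_eq.
by move=> j jk; rewrite !resample_neq// -val_eqE/= neq_ltn jk.
Qed.

Let v k om (j : 'I_n) : vec :=
  (H j (z_ k om) - H j (w_ k.-1 om)) + (H j (z_ k om) - H j (z_ k.-1 om)).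

Let xiE (k : 'I_K) om : xi k om = b%:R^-1 *: \sum_(j <- (om k).1) v k om j.
Proof.
rewrite /xi /delta_est /v mul1r -[X in X - _]addrA -scalerDr -big_split/=.
(* [c] is the average over [[n]] of the sampled terms [A j]; subtracting it leaves the summands
   [v k om j], which add up to zero over [[n]]. *)
set c := (G (z_ k om) - G (w_ k.-1 om)) + (G (z_ k om) - G (z_ k.-1 om)).
pose F_ j x := gradop (f j) x.
pose A j := (F_ j (z_ k om) - F_ i1 (z_ k om) - F_ j (w_ k.-1 om) + F_ i1 (w_ k.-1 om))
  + (F_ j (z_ k om) - F_ i1 (z_ k om) - F_ j (z_ k.-1 om) + F_ i1 (z_ k.-1 om)).
rewrite -[X in _ + _ *: X - _]/(\sum_(j <- (om k).1) A j).
rewrite [in RHS](eq_bigr (fun j => A j - c)); last first.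
  move=> j _; rewrite /A /c /H /G /F_.
  move: (F _) (F _) (F _) (gradop _ _) (gradop _ _) (gradop _ _) (gradop _ _) (gradop _ _) (gradop _ _).
  by move=> *; apply/rowP => i; rewrite !mxE; ring.
rewrite sumrB scalerBr big_const_seq count_predT size_tuple.
rewrite iter_addr_0 -[c *+ b]scaler_nat scalerA mulrC bE scale1r.
rewrite -[F (w_ _ _) - _]/(G (w_ k.-1 om)) /c.
move: (_ *: _) (G _) (G _) (G _) => *; apply/rowP => i; rewrite !mxE; ring.
Qed.

Let gamma_le1 : gamma <= 1.
Proof. by have := gamma1; lra. Qed.

Let v_indep (k : 'I_K) j om d : (j <= k)%N -> v j (resample om k d) = v j om.
Proof.
move=> jk; have pk : (j.-1 <= k)%N := leq_trans (leq_pred _) jk.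
have ez := z_indep om d jk; have ew := w_indep om d pk; have ep := z_indep om d pk.
by apply/funext => i; rewrite /v ez ew ep.
Qed.

Let xi_resample (k : 'I_K) om d : xi k (resample om k d) = b%:R^-1 *: \sum_(j <- d.1) v k om j.
Proof. by rewrite xiE resample_eq v_indep. Qed.

Let sum_v k om : \sum_j v k om j = 0.
Proof.
have sH x : \sum_j H j x = 0.
  rewrite /H sumrB sumr_const card_ord /Favg -[_ *+ n]scaler_nat scalerA nE scale1r.
  exact: subrr.
have E (c1 c2 c3 c4 : 'I_n -> vec) : \sum_j c1 j = 0 -> \sum_j c2 j = 0 ->
    \sum_j c3 j = 0 -> \sum_j c4 j = 0 -> \sum_j ((c1 j - c2 j) + (c3 j - c4 j)) = 0.
  by move=> s1 s2 s3 s4; rewrite big_split/= !sumrB s1 s2 s3 s4 !subrr addr0.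
by apply: E; exact: sH.
Qed.

Let Y_ k om := enorm (z_ k om - w_ k.-1 om).

Let v_sqr k om j : enorm (v k om j) ^+ 2 <= 2 * delta ^+ 2 * (Y_ k om ^+ 2 + X_ k om ^+ 2).
Proof.
have h (c d : R) : 0 <= c -> c <= delta * d -> c ^+ 2 <= delta ^+ 2 * d ^+ 2.
  by move=> c0 cd; rewrite -exprMn lerXn2r ?nnegrE// (le_trans c0).
have E (x y : vec) (s t : R) : enorm x <= delta * s -> enorm y <= delta * t ->
    enorm (x + y) ^+ 2 <= 2 * delta ^+ 2 * (s ^+ 2 + t ^+ 2).
  move=> /(h _ _ (enorm_ge0 _)) hx /(h _ _ (enorm_ge0 _)) hy.
  by apply: le_trans (enormD_sqr _ _) _; lra.
exact: E (sim _ _ _) (sim _ _ _).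
Qed.

Let xi_centered (k : 'I_K) om :
  \sum_d draw_weight gamma d *: xi k (resample om k d) = 0.
Proof.
under eq_bigr do rewrite xi_resample.
rewrite sum_draw_weight/=; under eq_bigr do rewrite -scalerDl subrKC scale1r.
by rewrite -!scaler_sumr sum_tuple_centered ?scaler0// sum_v.
Qed.

Let xi_var (k : 'I_K) : Expect gamma (fun om => enorm (xi k om) ^+ 2) <=
  Expect gamma (fun om => 2 * delta ^+ 2 / b%:R * (Y_ k om ^+ 2 + X_ k om ^+ 2)).
Proof.
rewrite (Expect_resample gamma n0 _ k); apply: ler_Expect => // [|om]; first exact: ltW.
under eq_bigr do rewrite xi_resample.
rewrite sum_draw_weightR/=; under eq_bigr do rewrite -mulrDl subrKC mul1r.
rewrite -mulr_sumr; under eq_bigr do rewrite enormZ exprMn.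
rewrite -mulr_sumr ger0_norm ?invr_ge0//.
have sq := sum_tuple_sqr b (sum_v k om).
set W := \sum_(s : b.-tuple 'I_n) _ in sq *.
have sv : \sum_j enorm (v k om j) ^+ 2 <= n%:R * (2 * delta ^+ 2 * (Y_ k om ^+ 2 + X_ k om ^+ 2)).
  rewrite mulr_natl -[X in _ *+ X]card_ord -sumr_const; apply: ler_sum => j _.
  exact: v_sqr.
have np : 0 < n%:R :> R by rewrite ltr0n.
have bp : 0 < b%:R :> R by rewrite ltr0n.
have -> : W = n%:R^-1 * (b%:R * n%:R ^+ b * \sum_j enorm (v k om j) ^+ 2).
  by rewrite -sq mulKf// gt_eqF.
have -> : n%:R^-1 ^+ b * (b%:R^-1 ^+ 2 * (n%:R^-1 * (b%:R * n%:R ^+ b * \sum_j enorm (v k om j) ^+ 2)))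
  = b%:R^-1 * n%:R^-1 * \sum_j enorm (v k om j) ^+ 2.
  rewrite exprVn; field; rewrite ?expf_neq0 ?gt_eqF//.
have c0 : 0 <= b%:R^-1 * n%:R^-1 :> R by rewrite mulr_ge0 ?invr_ge0.
apply: le_trans (ler_wpM2l c0 sv) _.
by rewrite le_eqVlt; apply/orP; left; apply/eqP; field; rewrite !gt_eqF.
Qed.

Let q_coin (k : 'I_K) om s :
  let D_ := z_ k.+1 (resample om k (s, true)) - w_ k om in
  q k (resample om k (s, true)) = (1 - gamma) *: D_ /\
  q k (resample om k (s, false)) = - gamma *: D_.
Proof.
rewrite /= /q !(run_w run) !resample_eq/= w_indep// w_indep// (z_coin k om s false true).
move: (z_ _ _) (w_ _ _) => x y.
by split; apply/rowP => i; rewrite !mxE; ring.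
Qed.

Let q_centered (k : 'I_K) om :
  \sum_d draw_weight gamma d *: q k (resample om k d) = 0.
Proof.
rewrite sum_draw_weight big1// => s _.
have [-> ->] := q_coin k om s.
by rewrite !scalerA -scalerDl mulrN mulrC subrr scale0r scaler0.
Qed.

(** Bernoulli variance [gamma * (1 - gamma)] times a squared displacement: by the index shift,
    [Y_ k.+1] is the distance from z^(k+1) to w^k. *)
Let q_var (k : 'I_K) : Expect gamma (fun om => enorm (q k om) ^+ 2) <=
  Expect gamma (fun om => gamma * Y_ k.+1 om ^+ 2).
Proof.
rewrite (Expect_resample gamma n0 _ k) [leRHS](Expect_resample gamma n0 _ k).
apply: ler_Expect => // [|om]; first exact: ltW.
rewrite !sum_draw_weightR; apply: ler_sum => s _.
rewrite ler_wpM2l ?exprn_ge0 ?invr_ge0//.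
have [-> ->] := q_coin k om s.
rewrite /Y_ /= !w_indep// (z_coin k om s false true).
rewrite !enormZ; set E := enorm _; rewrite normrN !exprMn !real_normK ?num_real//.
have : 0 <= gamma ^+ 2 * E ^+ 2 by rewrite mulr_ge0 ?sqr_ge0.
lra.
Qed.

Let noise_centered (k : 'I_K) : Expect gamma (fun om => noise k om) = 0.
Proof.
rewrite (Expect_resample gamma n0 _ k) -[RHS](Expect_cst b K gamma n0 0).
apply: eq_Expect => om; rewrite sum_draw_weightR big1// => s _.
rewrite /noise !(run_w run) !resample_eq/= !w_indep// (z_coin k om s false true).
ring.
Qed.

Let xi_indep (j k : 'I_K) : (j < k)%N -> indep_of k (xi j).
Proof.
move=> jk om d; rewrite !xiE resample_neq; last by rewrite -val_eqE/= neq_ltn jk.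
by rewrite v_indep// ltnW.
Qed.

Let q_indep (j k : 'I_K) : (j < k)%N -> indep_of k (q j).
Proof.
move=> jk om d; have jk' := ltnW jk.
have ez := z_indep om d jk; have ew := w_indep om d jk.
by have ew' := w_indep om d jk'; rewrite /q ez ew ew'.
Qed.

Let Y_next (k : 'I_K) om : Y_ k.+1 om ^+ 2 <= 2 * a k om ^+ 2 + 50^-1 * r k om ^+ 2.
Proof.
have h : Y_ k.+1 om ^+ 2 <= (e k om + a k om) ^+ 2.
  rewrite lerXn2r ?nnegrE ?addr_ge0 ?enorm_ge0//; exact: enorm_triang.
have h2 : e k om ^+ 2 <= (10^-1 * r k om) ^+ 2.
  by rewrite lerXn2r ?nnegrE ?mulr_ge0 ?enorm_ge0.
have := sqr_ge0 (e k om - a k om); lra.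
Qed.

Let X_next (k : 'I_K) om : X_ k.+1 om ^+ 2 <= 5 / 4 * r k om ^+ 2.
Proof.
have h2 : X_ k.+1 om ^+ 2 <= (11 / 10 * r k om) ^+ 2.
  rewrite lerXn2r ?nnegrE ?enorm_ge0//; last exact: step_len.
  by apply: mulr_ge0; [lra|exact: enorm_ge0].
have := sqr_ge0 (r k om); lra.
Qed.

(** What a step leaves after Young's inequality: of [16 * (1 - gamma) >= 128 / 9], the two products
    with [r] spend 1/2 and 2 and the inexactness 0.16, so at least 11 remains. *)
Let drift k om := delta * (2^-1 * X_ k om ^+ 2 - 11 * r k om ^+ 2 - 16 * gamma * a k om ^+ 2).

Let cost_le (k : 'I_K) om : cost k om <=
  (epsilon / 4 + ((8 * delta)^-1 * enorm (xi k om) ^+ 2 + drift k om))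
  + (- 1 * dot (z_ k om - z0) (xi k om) + - (16 * delta) * noise k om).
Proof.
rewrite /cost /drift -/(X_ k om).
move: (dot _ _) (noise k om) (e_le_r k om) (enorm_ge0 (z_ k.+1 om - uh_ k om)) => t1 t2.
rewrite -/(e k om); move: (X_ k om) (r k om) (a k om) (e k om) (enorm (xi k om)) => x r' a' e' s er e0.
have xr : delta * x * r' <= delta * (2^-1 * x ^+ 2 + 2^-1 * r' ^+ 2).
  rewrite -mulrA ler_wpM2l ?(ltW delta0)//; have := sqr_ge0 (x - r'); lra.
have sr : s * r' <= (8 * delta)^-1 * s ^+ 2 + 2 * delta * r' ^+ 2.
  have : 0 <= (8 * delta)^-1 * (s - 4 * delta * r') ^+ 2.
    by rewrite mulr_ge0 ?sqr_ge0// invr_ge0; have := delta0; lra.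
  have -> : (8 * delta)^-1 * (s - 4 * delta * r') ^+ 2 =
    (8 * delta)^-1 * s ^+ 2 - s * r' + 2 * delta * r' ^+ 2.
    by field; rewrite gt_eqF.
  lra.
have ee : delta * e' ^+ 2 <= delta * (10^-1 * r') ^+ 2.
  rewrite ler_wpM2l ?(ltW delta0)// lerXn2r ?nnegrE// (le_trans e0)//.
have dr : 0 <= delta * r' ^+ 2 by rewrite mulr_ge0 ?sqr_ge0 ?(ltW delta0).
have gr : delta * r' ^+ 2 * gamma <= delta * r' ^+ 2 * 9^-1 by exact: ler_wpM2l.
lra.
Qed.

(** The factor [(4 * delta)^-1] is twice [(8 * delta)^-1], once from [cost_le] and once from the
    summed errors in [bound]. After the index shift the coefficients, in units of [delta], are at
    most [- 10 + 5 / 4 + 1 / 100] for [r ^+ 2] and [(- 12 + 9) * gamma] for [a ^+ 2]. *)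
Let drift_sum om :
  \sum_(k < K) (drift k om + (4 * delta)^-1 * (2 * delta ^+ 2 / b%:R * (Y_ k om ^+ 2 + X_ k om ^+ 2))
    + 2 * delta * (gamma * Y_ k.+1 om ^+ 2)) <= 0.
Proof.
have bp : 0 < b%:R :> R by rewrite ltr0n.
have ib : b%:R^-1 <= 9 * gamma by rewrite -[leLHS]mul1r ler_pdivrMr.
have sX : \sum_(k < K) X_ k om ^+ 2 <= \sum_(k < K) (5 / 4 * r k om ^+ 2).
  apply: (ler_sum_shift (g := fun k => X_ k om ^+ 2) (h := fun k => 5 / 4 * r k om ^+ 2)).
  - by rewrite /X_ /= subrr enorm0 expr0n.
  - by move=> k; rewrite mulr_ge0 ?sqr_ge0.
  - by move=> k kK; exact: (X_next (Ordinal kK)).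
have sY : \sum_(k < K) Y_ k om ^+ 2 <= \sum_(k < K) (2 * a k om ^+ 2 + 50^-1 * r k om ^+ 2).
  apply: (ler_sum_shift (g := fun k => Y_ k om ^+ 2) (h := fun k => 2 * a k om ^+ 2 + 50^-1 * r k om ^+ 2)).
  - by rewrite /Y_ /= (run_z0 run) (run_w0 run) subrr enorm0 expr0n.
  - by move=> k; have := sqr_ge0 (a k om); have := sqr_ge0 (r k om); lra.
  - by move=> k kK; exact: (Y_next (Ordinal kK)).
apply: (@le_trans _ _ (\sum_(k < K) (delta * X_ k om ^+ 2 + (9 / 2 * gamma * delta) * Y_ k om ^+ 2
   - delta * (10 * r k om ^+ 2 + 12 * gamma * a k om ^+ 2)))).
  apply: ler_sum => k _; rewrite /drift; have yn := Y_next k om.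
  have -> : (4 * delta)^-1 * (2 * delta ^+ 2 / b%:R * (Y_ k om ^+ 2 + X_ k om ^+ 2)) =
    2^-1 * delta * (b%:R^-1 * (Y_ k om ^+ 2 + X_ k om ^+ 2)).
    by field; rewrite !gt_eqF.
  move: (Y_ k om) (X_ k om) (Y_ k.+1 om) (r k om) (a k om) yn => y x y' r' a' yn.
  have d0 := ltW delta0; have g0 := ltW gamma0.
  have h1 : delta * (b%:R^-1 * y ^+ 2) <= delta * (9 * gamma * y ^+ 2).
    by rewrite ler_wpM2l// ler_wpM2r// sqr_ge0.
  have h2 : delta * (b%:R^-1 * x ^+ 2) <= delta * (1 * x ^+ 2).
    rewrite ler_wpM2l// ler_wpM2r// ?sqr_ge0//; have := gamma1; have := ib; lra.
  have h3 : delta * (gamma * y' ^+ 2) <= delta * (gamma * (2 * a' ^+ 2 + 50^-1 * r' ^+ 2)).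
    by rewrite !ler_wpM2l.
  have h4 : delta * (gamma * r' ^+ 2) <= delta * (9^-1 * r' ^+ 2).
    by rewrite ler_wpM2l// ler_wpM2r// sqr_ge0.
  have h5 : 0 <= delta * r' ^+ 2 by rewrite mulr_ge0 ?sqr_ge0.
  lra.
rewrite sumrB big_split/= -!mulr_sumr.
have d1 := ler_wpM2l (ltW delta0) sX.
have c0 : 0 <= 9 / 2 * gamma * delta.
  by apply: mulr_ge0; [have := gamma0; lra|exact: ltW].
have d2 := ler_wpM2l c0 sY.
rewrite !big_split/= -!mulr_sumr in d1 d2 *.
have r0 : 0 <= \sum_(k < K) r k om ^+ 2 by apply: sumr_ge0 => k _; exact: sqr_ge0.
have a0 : 0 <= \sum_(k < K) a k om ^+ 2 by apply: sumr_ge0 => k _; exact: sqr_ge0.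
move: (\sum_(k < K) r k om ^+ 2) (\sum_(k < K) a k om ^+ 2) r0 a0 d1 d2 => A B A0 B0 d1 d2.
have h1 : 0 <= delta * A by rewrite mulr_ge0 ?(ltW delta0).
have h2 : 0 <= delta * (gamma * B) by rewrite !mulr_ge0 ?(ltW delta0) ?(ltW gamma0).
have h3 : delta * A * gamma <= delta * A * 9^-1 by rewrite ler_wpM2l.
lra.
Qed.

Let Expect_bound : Expect gamma bound <= 164 * (delta * D ^+ 2) + K%:R * (epsilon / 4).
Proof.
have g0 := ltW gamma0.
have d8 : 0 <= (8 * delta)^-1 by rewrite invr_ge0; have := delta0; lra.
have dE : (8 * delta)^-1 + (8 * delta)^-1 = (4 * delta)^-1 by field; rewrite gt_eqF.
rewrite /bound !ExpectD !ExpectZ (Expect_cst _ _ _ n0) Expect_sum.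
rewrite (Expect_martingale_sqr n0 xi_indep xi_centered).
rewrite (Expect_martingale_sqr n0 q_indep q_centered).
have C (k : 'I_K) : Expect gamma (cost k) <= epsilon / 4 +
    ((8 * delta)^-1 * Expect gamma (fun om => enorm (xi k om) ^+ 2) + Expect gamma (drift k)).
  apply: le_trans (ler_Expect _ _ (cost_le k)) _ => //.
  rewrite !ExpectD !ExpectZ (Expect_cst _ _ _ n0) noise_centered.
  rewrite (Expect_dot_centered n0 (k := k)) ?mulr0 ?addr0//.
  by move=> om d; rewrite z_indep.
have E0 := Expect_cst b K gamma n0 0.
have DS := ler_Expect g0 gamma_le1 drift_sum; rewrite E0 Expect_sum in DS.
have S : \sum_(k < K) (Expect gamma (cost k) + (8 * delta)^-1 * Expect gamma (fun om => enorm (xi k om) ^+ 2)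
    + 2 * delta * Expect gamma (fun om => enorm (q k om) ^+ 2)) <= \sum_(k < K) (epsilon / 4).
  rewrite -[leRHS]addr0; apply: le_trans (lerD (lexx _) DS).
  rewrite -big_split/=; apply: ler_sum => k _.
  have comb (g1 g2 g3 : Omega -> R) c2 c3 :
      Expect gamma (fun om => g1 om + c2 * g2 om + c3 * g3 om) =
      Expect gamma g1 + c2 * Expect gamma g2 + c3 * Expect gamma g3.
    by rewrite !ExpectD !ExpectZ.
  rewrite comb.
  have d4 : 0 <= (4 * delta)^-1 by rewrite invr_ge0; have := delta0; lra.
  have d2 : 0 <= 2 * delta by have := delta0; lra.
  have h1 := ler_wpM2l d4 (xi_var k); have h2 := ler_wpM2l d2 (q_var k).
  have := C k; rewrite -dE in h1 *; lra.
rewrite sumr_const card_ord -[leRHS]mulr_natl !big_split/= -!mulr_sumr in S.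
lra.
Qed.

Lemma svogs_expected_gap : (0 < K)%N ->
  Expect gamma (fun om => Gap X Y (favg f) (uavg tr om))
    <= 164 * (delta * D ^+ 2 / K%:R) + epsilon / 4.
Proof.
move=> K0; have Kp : 0 < K%:R :> R by rewrite ltr0n.
apply: (@le_trans _ _ (Expect gamma (fun om => K%:R^-1 * bound om))).
  apply: ler_Expect => // [|om]; first exact: ltW.
  apply: Gap_mean_le => //; first by exists z0.
  - by move=> z; exact: differentiable_favg.
  - exact: convex_concave_favg.
  move=> z Zz; apply: le_trans (regret_le om K0 Zz).
  by apply: ler_sum => k _; rewrite gradop_favg// (run_z run).
rewrite ExpectZ ler_pdivrMl//; apply: le_trans Expect_bound _.
rewrite le_eqVlt; apply/orP; left; apply/eqP; field.
by rewrite gt_eqF.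
Qed.

End Descent.

(** * Runs solved by extra-gradient *)

Section Execution.
Variables (R : realType) (dx dy n b K : nat).
Local Notation vec := 'rV[R]_(dx + dy).
Local Notation Omega := (outcome n b K).
Variables (X : set 'rV[R]_dx) (Y : set 'rV[R]_dy).
Variables (f : 'I_n -> vec -> R) (i1 : 'I_n) (eta gamma alpha L D zeta chat : R).
Variables (z0 : vec) (T : nat).
Local Notation Z := (prodset X Y).
Hypotheses (eta0 : 0 < eta) (L0 : 0 < L).
Hypotheses (Zne : Z !=set0) (cZ : closed Z) (cvZ : convex_set Z) (Zz0 : Z z0).
Hypothesis ZD : forall z1 z2, Z z1 -> Z z2 -> enorm (z1 - z2) <= D.
Hypotheses (df : forall z, differentiable (f i1) z) (cc : convex_concave (f i1)).
Hypothesis fL : forall z1 z2,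
  enorm (gradop (f i1) z1 - gradop (f i1) z2) <= L * enorm (z1 - z2).

Let tau : R := (4 * (L + eta^-1))^-1.

Hypothesis T_large : forall r : R, 0 <= r -> r <= D ->
  (1 - tau * eta^-1) ^+ T * r ^+ 2 <= Num.min zeta (chat^-1 * Num.min r (r ^+ 2)).

Let tau0 : 0 < tau.
Proof. by rewrite invr_gt0 mulr_gt0// addr_gt0// invr_gt0. Qed.

Let tauL : tau * (L + eta^-1) = 4^-1.
Proof. by rewrite /tau invfM -mulrA mulVf ?mulr1// gt_eqF// addr_gt0// invr_gt0. Qed.

Let contraction_ge0 : 0 <= 1 - tau * eta^-1.
Proof.
have : tau * eta^-1 <= tau * (L + eta^-1).
  by rewrite ler_wpM2l ?(ltW tau0)// lerDr ltW.
rewrite tauL; lra.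
Qed.

Lemma sub_saddle_exists v : exists u, saddle X Y (sub_obj (f i1) eta v) u.
Proof.
have le : eta^-1 <= L + eta^-1 by rewrite lerDr ltW.
have e0 : 0 < eta^-1 by rewrite invr_gt0.
have [q Zq vi] := vi_exists Zne cZ cvZ ZD e0 le
  (sub_op_strongly_monotone eta df cc v) (fun u w => sub_op_lipschitz eta0 v u w fL).
by exists q; apply: sub_vi_saddle.
Qed.

Local Notation step v := (eg_step Z (sub_op (f i1) eta v) tau).

Lemma iter_eg_in v z : Z z -> Z (iter T (step v) z).
Proof. by move=> Zz; elim: T => //= t _; exact: (proj_in Zne cZ ZD). Qed.

(** Starting at z^k makes the initial error equal to the distance that scales the tolerance. It is
    at most [D] because exact projections keep these iterates in [Z], so a single [T] serves all
    subproblems. *)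
Lemma iter_eg_close v z u : Z z -> saddle X Y (sub_obj (f i1) eta v) u ->
  enorm (iter T (step v) z - u) ^+ 2 <=
  Num.min zeta (chat^-1 * Num.min (enorm (u - z)) (enorm (u - z) ^+ 2)).
Proof.
move=> Zz su; have [Zu _ _] := su.
have vi := sub_saddle_vi cvZ eta0 df su.
have le : eta^-1 <= L + eta^-1 by rewrite lerDr ltW.
have e0 : 0 < eta^-1 by rewrite invr_gt0.
apply: le_trans (T_large (enorm_ge0 _) (ZD Zu Zz)); rewrite (enormC u z).
elim: T => [|t IH]; first by rewrite expr0 mul1r.
rewrite iterS [_ ^+ t.+1]exprS -mulrA.
apply: le_trans (eg_step_contraction Zne cZ cvZ ZD e0 le
  (sub_op_strongly_monotone eta df cc v) (fun x w => sub_op_lipschitz eta0 v x w fL)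
  _ tau0 tauL Zu vi) _.
by rewrite ler_wpM2l.
Qed.

(* A state is [(z^k, w^k, z^(k-1), w^(k-1))]. *)
Let state : Type := (vec * vec * vec * vec)%type.

Let vstate (s : state) (S : b.-tuple 'I_n) : vec :=
  let: (zk, wk, zp, wp) := s in
  let F j := gradop (f j) in
  (1 - gamma) *: zk + gamma *: wk - eta *:
  (Favg f wp - F i1 wp
  + b%:R^-1 *: (\sum_(j <- S) (F j zk - F i1 zk - F j wp + F i1 wp))
  + (alpha / b%:R) *: (\sum_(j <- S) (F j zk - F i1 zk - F j zp + F i1 zp))).

Let nextz (s : state) (d : draw n b) : vec :=
  iter T (step (vstate s d.1)) s.1.1.1.

Let next (s : state) (d : draw n b) : state :=
  let z' := nextz s d in
  (z', if d.2 then z' else s.1.1.2, s.1.1.1, s.1.1.2).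

(** No draw exists beyond the horizon, where the state is left unchanged; the initial state encodes
    z^(-1) = w^(-1) = z^0. *)
Let states : nat -> Omega -> state := fix states k om :=
  if k is k'.+1 then
    if insub k' is Some i then next (states k' om) (om i) else states k' om
  else (z0, z0, z0, z0).

Let eg_trace : trace R (dx + dy) n b K :=
  Trace (fun k om => (states k om).1.1.1) (fun k om => (states k om).1.1.2)
    (fun k om => (states k.+1 om).1.1.1)
    (fun k om => if insub k is Some i then
       xget z0 (saddle X Y (sub_obj (f i1) eta (vstate (states k om) (om i).1)))
     else z0).

Let statesS (k : 'I_K) om : states k.+1 om = next (states k om) (om k).
Proof. by rewrite /= valK. Qed.

Let states_prev (k : 'I_K) om :
  (states k om).1.2 = (states k.-1 om).1.1.1 /\ (states k om).2 = (states k.-1 om).1.1.2.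
Proof.
case: k => -[//|k] kK; have kK' := ltnW kK.
by have := statesS (Ordinal kK') om; rewrite /= => ->.
Qed.

Let vvecE (k : 'I_K) om :
  vvec f i1 eta gamma alpha eg_trace k om = vstate (states k om) (om k).1.
Proof.
rewrite /vvec /zbar /delta_est /=.
by have [] := states_prev k om; case: (states k om) => -[[z w] zp] wp /= -> ->.
Qed.

Let states_in k om : Z (states k om).1.1.1.
Proof.
by elim: k => [//|k IH] /=; case: insubP => //= i _ _; exact: iter_eg_in.
Qed.

Let uhatP (k : 'I_K) om :
  saddle X Y (sub_obj (f i1) eta (vvec f i1 eta gamma alpha eg_trace k om))
    (uhats eg_trace k om).
Proof.
rewrite vvecE /= valK; apply: xgetPex.
exact: sub_saddle_exists.
Qed.

Let states_adapted k (om om' : Omega) : (k <= K)%N ->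
  (forall j : 'I_K, (j < k)%N -> om j = om' j) -> states k om = states k om'.
Proof.
elim: k => [//|k IH] kK H /=; rewrite insubT; rewrite IH ?H//; first exact: ltnW.
by move=> j jk; apply: H; exact: ltnW.
Qed.

(** With a constant number of steps, u^k is a function of the state and of the current batch, whence
    adaptedness; the exact saddle point only certifies the accuracy. *)
Lemma svogs_eg_run_exists : exists tr : trace R (dx + dy) n b K,
  svogs_run X Y f i1 eta gamma alpha z0
    (fun k om => let r := enorm (uhats tr k om - zs tr k om) in
       Num.min zeta (chat^-1 * Num.min r (r ^+ 2))) tr /\
  solved_by_eg X Y f i1 eta gamma alpha L tr (fun _ _ => T).
Proof.
exists eg_trace; have usE (k : 'I_K) om : us eg_trace k om =
    iter T (step (vvec f i1 eta gamma alpha eg_trace k om)) (zs eg_trace k om).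
  by rewrite vvecE [LHS]/= valK.
split=> //; split=> //.
- by move=> k om; rewrite usE; apply: iter_eg_close => //; exact: states_in.
- move=> k om om' H1 H2; rewrite !usE !vvecE H2.
  by rewrite /= (states_adapted (ltnW (ltn_ord k)) H1).
- by move=> k om; rewrite /= valK.
Qed.

End Execution.

(** * Costs and parameters *)

Section Costs.
Variables (R : realType) (n b K : nat) (p : R).
Hypothesis n0 : (0 < n)%N.
Local Notation Omega := (outcome n b K).

Lemma Expect_coin (k : 'I_K) :
  Expect p (fun om : Omega => (if (om k).2 then n else 0)%:R) = p * n%:R.
Proof.
rewrite (Expect_resample p n0 _ k) -[RHS](Expect_cst b K p n0).
apply: eq_Expect => om; under eq_bigr do rewrite resample_eq.
rewrite sum_draw_weightR/= -[RHS](sum_tuple_weight b n0).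
by apply: eq_bigr => s _; rewrite mulr0 addr0.
Qed.

Lemma Expect_refresh_cost (m : nat) :
  Expect p (fun om : Omega => (n + \sum_(k < K) (m + (if (om k).2 then n else 0)))%N%:R)
  = n%:R + K%:R * (m%:R + p * n%:R).
Proof.
under eq_Expect do rewrite natrD natr_sum.
rewrite ExpectD (Expect_cst _ _ _ n0) Expect_sum; congr (_ + _).
rewrite -[X in _ = X%:R * _](card_ord K) mulr_natl -sumr_const.
apply: eq_bigr => k _; under eq_Expect do rewrite natrD.
by rewrite ExpectD (Expect_cst _ _ _ n0) Expect_coin.
Qed.

End Costs.

Lemma natr_absz_ceil (R : realType) (y : R) : 0 <= y ->
  y <= (`|Num.ceil y|%N)%:R /\ (`|Num.ceil y|%N)%:R <= y + 1.
Proof.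
move=> y0; have c0 : 0 <= Num.ceil y by rewrite ceil_ge0// (lt_le_trans _ y0).
rewrite natr_absz ger0_norm//; split; first exact: ceil_ge.
by rewrite ltW// -ltrBlDr; have := ceil_itv y; case/andP; rewrite intrB.
Qed.

Lemma pow_le_expR (R : realType) (x : R) (T : nat) : x <= 1 ->
  (1 - x) ^+ T <= expR (- (x * T%:R)).
Proof.
move=> x1; apply: (@le_trans _ _ (expR (- x) ^+ T)).
  by rewrite lerXn2r ?nnegrE ?subr_ge0 ?expR_ge0// expR_ge1Dx.
by rewrite -expRM_natr mulNr.
Qed.

Lemma ln2_le1 (R : realType) : ln 2 <= 1 :> R.
Proof. by have := @le_ln1Dx R 1; apply; lra. Qed.

Lemma ln_one_plus_le (R : realType) (x : R) : 0 < x -> ln (1 + x) <= 1 + `|ln x|.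
Proof.
move=> x0; have [x1|x1] := leP x 1.
  apply: (@le_trans _ _ 1); last by rewrite lerDl.
  apply: (@le_trans _ _ (ln 2)); first by rewrite ler_ln ?posrE//; lra.
  exact: ln2_le1.
apply: (@le_trans _ _ (ln (2 * x))).
  by rewrite ler_ln ?posrE//; lra.
rewrite lnM ?posrE//; apply: lerD; last exact: ler_norm.
exact: ln2_le1.
Qed.

(** The three tolerances ask that the power times [D ^+ 2 / zeta], [D * chat] and [chat] be at most
    1; the product inside the logarithm dominates all three. *)
Lemma eg_accuracy (R : realType) (x zeta chat D r : R) (T : nat) :
  0 <= x -> x <= 1 -> 0 < zeta -> 1 <= chat -> 0 < D ->
  ln ((1 + D ^+ 2 / zeta) * ((1 + D) * chat)) <= x * T%:R ->
  0 <= r -> r <= D ->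
  (1 - x) ^+ T * r ^+ 2 <= Num.min zeta (chat^-1 * Num.min r (r ^+ 2)).
Proof.
move=> x0 x1 z0 c0 D0 lnT r0 rD; set A := _ * _ in lnT.
have dz : 0 < D ^+ 2 / zeta by rewrite divr_gt0 ?exprn_gt0.
have D1 : 0 < (1 + D) * chat by apply: mulr_gt0; lra.
have A0 : 0 < A by rewrite mulr_gt0//; lra.
set c := (1 - x) ^+ T.
have cp : 0 <= c by rewrite exprn_ge0//; lra.
have cA : c * A <= 1.
  rewrite -ler_pdivlMr// mul1r; apply: le_trans (pow_le_expR T x1) _.
  by rewrite -[leRHS]lnK ?posrE ?invr_gt0// ler_expR lnV ?posrE// lerN2.
have B1 : 1 <= (1 + D) * chat.
  by rewrite -[leLHS]mulr1; apply: ler_pM => //; lra.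
have Az : D ^+ 2 / zeta <= A.
  apply: (@le_trans _ _ ((1 + D ^+ 2 / zeta) * 1)); first lra.
  by rewrite ler_wpM2l//; lra.
have AB : (1 + D) * chat <= A.
  by rewrite -[leLHS]mul1r ler_wpM2r ?(ltW D1)//; lra.
have Ac : chat <= A.
  by apply: le_trans AB; rewrite -[leLHS]mul1r ler_wpM2r//; lra.
have AD : D * chat <= A by apply: le_trans AB; rewrite ler_wpM2r//; lra.
have small (w s : R) : 0 <= s -> w <= A * s -> c * w <= s.
  move=> s0 ws; apply: le_trans (ler_wpM2l cp ws) _.
  by rewrite mulrA -[leRHS]mul1r ler_wpM2r.
have r2D : r ^+ 2 <= D ^+ 2 by rewrite lerXn2r ?nnegrE ?(ltW D0).
have ch0 : 0 < chat by lra.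
rewrite le_min; apply/andP; split.
  apply: small; first exact: ltW.
  by apply: le_trans r2D _; rewrite -ler_pdivrMr.
rewrite ler_pdivlMl// le_min; apply/andP; split; rewrite mulrCA; apply: small => //.
- rewrite expr2 mulrA ler_wpM2r//; apply: le_trans AD.
  by rewrite [leRHS]mulrC ler_wpM2l//; lra.
- exact: sqr_ge0.
- by rewrite ler_wpM2r ?sqr_ge0.
Qed.

Lemma ln_accuracy_le (R : realType) (n : nat) (L delta D M epsilon zeta chat eta : R) :
  (0 < n)%N -> 0 < delta -> delta <= L -> 0 < D -> 0 <= M -> 0 < epsilon ->
  eta = (32 * delta)^-1 ->
  zeta = Num.min
      (eta ^+ 2 * epsilon ^+ 2 / (16 * (9 * eta * L * D + 3 * eta * M + D) ^+ 2))
      (eta * epsilon / (4 * (12 * eta ^+ 2 * delta ^+ 2 + 1))) ->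
  1 <= chat -> chat <= 128 * (1 + D) ->
  0 < zeta /\ ln ((1 + D ^+ 2 / zeta) * ((1 + D) * chat)) <=
  600 * (log_factor n L delta D M * Num.max 1 (ln epsilon^-1)).
Proof.
move=> n0 d0 dL D0 M0 e0 etaE zetaE c1 c2.
have L0 : 0 < L := lt_le_trans d0 dL.
have et0 : 0 < eta by rewrite etaE invr_gt0 mulr_gt0.
set W := 9 * eta * L * D + 3 * eta * M + D in zetaE.
have W0 : 0 < W.
  by rewrite ltr_wpDl// addr_ge0// !mulr_ge0// ltW.
have den0 : 0 < 4 * (12 * eta ^+ 2 * delta ^+ 2 + 1).
  by have := mulr_ge0 (sqr_ge0 eta) (sqr_ge0 delta); lra.
have z0 : 0 < zeta.
  rewrite zetaE lt_min; apply/andP; split; apply: divr_gt0 => //.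
  - by rewrite mulr_gt0 ?exprn_gt0.
  - by rewrite mulr_gt0// exprn_gt0.
  - exact: mulr_gt0.
split=> //.
set i := epsilon^-1; have i0 : 0 < i by rewrite invr_gt0.
have iE : epsilon * i = 1 by rewrite mulfV// gt_eqF.
(* A product of factors at least 1, so it dominates the monomials met below; [delta] is absorbed
   through [delta <= L]. *)
set P := (1 + L) * ((1 + D) ^+ 2 * ((1 + M) * (1 + i))).
have sq1 (a : R) : 1 <= a -> 1 <= a ^+ 2 by move=> ?; rewrite exprn_ege1.
have m1 (a c : R) : 1 <= a -> 1 <= c -> 1 <= a * c.
  by move=> a1 c1'; rewrite -[leLHS]mulr1; apply: ler_pM.
have P1 : 1 <= P by rewrite !m1 ?sq1//; lra.
have zb : 1 + D ^+ 2 / zeta <= (200 * P) ^+ 2.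
  have P2 : 1 <= P ^+ 2 := sq1 _ P1.
  have PP : P <= P ^+ 2 by rewrite expr2 -[leLHS]mulr1 ler_wpM2l//; lra.
  (* 176 is [4 * 44]: the first branch of the minimum gives [16 * (44 * P) ^+ 2]. *)
  suff : D ^+ 2 / zeta <= (176 * P) ^+ 2 by lra.
  have [E|E] : zeta = eta ^+ 2 * epsilon ^+ 2 / (16 * W ^+ 2) \/
      zeta = eta * epsilon / (4 * (12 * eta ^+ 2 * delta ^+ 2 + 1)).
    by rewrite zetaE; case: leP; [left|right].
  - have -> : D ^+ 2 / zeta = 16 * ((W / eta) * D * i) ^+ 2.
      by rewrite E /i; field; rewrite !gt_eqF.
    have We : W / eta <= 41 * (L * D) + 3 * M.
      have -> : W / eta = 9 * (L * D) + 3 * M + 32 * (delta * D).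
        by rewrite /W etaE; field; rewrite gt_eqF.
      have : delta * D <= L * D by rewrite ler_wpM2r// ltW.
      lra.
    have h1 : 41 * (L * D) + 3 * M <= 44 * ((1 + L) * ((1 + D) * (1 + M))).
      have := mulr_gt0 L0 D0; have := mulr_ge0 (ltW L0) M0; have := mulr_ge0 (ltW D0) M0.
      have := mulr_ge0 (mulr_ge0 (ltW L0) (ltW D0)) M0; lra.
    have h2 : W / eta * D * i <= 44 * P.
      have -> : 44 * P = 44 * ((1 + L) * ((1 + D) * (1 + M))) * (1 + D) * (1 + i).
        by rewrite /P; ring.
      have We0 : 0 < W / eta by rewrite divr_gt0.
      apply: ler_pM; [|exact: ltW| |lra]; first by rewrite mulr_ge0// ltW.
      apply: ler_pM; [exact: ltW|exact: ltW| |lra].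
      exact: le_trans We h1.
    have h3 : (W / eta * D * i) ^+ 2 <= (44 * P) ^+ 2.
      rewrite lerXn2r ?nnegrE//; last lra.
      by rewrite !mulr_ge0 ?invr_ge0// ltW.
    lra.
  - have -> : D ^+ 2 / zeta = 4 * (12 * (eta * delta) ^+ 2 + 1) * (D ^+ 2 * (eta^-1 * i)).
      rewrite E /i; field; rewrite !gt_eqF//.
      by move: den0; rewrite pmulr_rgt0.
    have -> : eta * delta = 32^-1 by rewrite etaE; field; rewrite gt_eqF.
    have -> : eta^-1 = 32 * delta by rewrite etaE invrK.
    have h1 : D ^+ 2 * (delta * i) <= D ^+ 2 * (L * i).
      by rewrite ler_wpM2l ?sqr_ge0// ler_wpM2r// ltW.
    have h2 : D ^+ 2 * (L * i) <= P.
      have -> : P = (1 + D) ^+ 2 * ((1 + L) * (1 + i)) * (1 + M) by rewrite /P; ring.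
      rewrite -[leLHS]mulr1; apply: ler_pM => //; last lra.
        by rewrite mulr_ge0 ?sqr_ge0// mulr_ge0 ?ltW.
      apply: ler_pM; rewrite ?sqr_ge0//; first by rewrite mulr_ge0 ?ltW.
        by rewrite lerXn2r ?nnegrE//; lra.
      by apply: ler_pM; rewrite ?(ltW L0) ?(ltW i0)//; lra.
    lra.
have lin (a c : R) : 0 < a -> 0 < c -> ln (a * c) = ln a + ln c.
  by move=> ? ?; rewrite lnM.
have l0 : 0 < 1 + L by lra.
have dd0 : 0 < 1 + D by lra.
have mm0 : 0 < 1 + M by lra.
have u0 : 0 < 1 + i by lra.
have P0 : 0 < P by lra.
set ME := Num.max 1 (ln i); set G := log_factor _ _ _ _ _ * ME.
have ME1 : 1 <= ME by rewrite le_max lexx.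
have MEi : ln i <= ME by rewrite le_max lexx orbT.
have lu : ln (1 + i) <= 2 * ME.
  have [i1|i1] := leP i 1.
    apply: (@le_trans _ _ (ln 2)); first by rewrite ler_ln ?posrE//; lra.
    by have := ln2_le1 R; lra.
  apply: (@le_trans _ _ (ln (2 * i))); first by rewrite ler_ln ?posrE//; lra.
  by rewrite lin//; have := ln2_le1 R; lra.
have lP : ln P = ln (1 + L) + (2 * ln (1 + D) + (ln (1 + M) + ln (1 + i))).
  rewrite /P lin ?mulr_gt0 ?exprn_gt0// lin ?mulr_gt0 ?exprn_gt0// lin//.
  by rewrite lnXn// mulr_natl.
have c0 : 0 < chat by lra.
have lz : ln (1 + D ^+ 2 / zeta) <= 2 * (200 + ln P).
  have sqr_ln (y c : R) : 0 < y -> 0 < c -> y <= c ^+ 2 -> ln y <= 2 * ln c.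
    by move=> y0 c0' yc; rewrite mulr_natl -lnXn// ler_ln ?posrE ?exprn_gt0.
  have p200 : 0 < 200 * P := mulr_gt0 (ltr0Sn _ _) P0.
  have y0 : 0 < 1 + D ^+ 2 / zeta by rewrite ltr_pwDl// divr_ge0 ?sqr_ge0// ltW.
  apply: le_trans (sqr_ln _ _ y0 p200 zb) _.
  rewrite (lin _ _ (ltr0Sn _ _) P0).
  have := @ln_sublinear R 200 (ltr0Sn _ _); move: (ln _) (ln _); clear => a c ac.
  lra.
have lc : ln chat <= 128 + ln (1 + D).
  apply: (@le_trans _ _ (ln (128 * (1 + D)))).
    by rewrite ler_ln ?posrE// mulr_gt0.
  rewrite lin//; have := @ln_sublinear R 128 (ltr0Sn _ _); lra.
have dz : 0 < 1 + D ^+ 2 / zeta by rewrite ltr_pwDl// divr_ge0 ?sqr_ge0// ltW.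
rewrite lin ?mulr_gt0// lin//.
have lL := ln_one_plus_le L0; have lD := ln_one_plus_le D0.
have lM : 0 <= ln (1 + M) by rewrite ln_ge0// lerDl.
have ln0 : 0 <= ln (n%:R : R) by rewrite ln_ge0// ler1n.
have LgG : log_factor n L delta D M <= G.
  rewrite /G -[leLHS]mulr1 ler_wpM2l// /log_factor.
  by rewrite !addr_ge0.
have MG : ME <= G.
  rewrite /G -[leLHS]mul1r ler_wpM2r//; first lra.
  by rewrite /log_factor -!addrA lerDl !addr_ge0.
move: LgG; rewrite /log_factor.
have := normr_ge0 (ln delta); have := normr_ge0 (ln L); have := normr_ge0 (ln D).
lra.
Qed.

(** * Consequences of the choice of batch size, probability and step size *)

Section StepSizes.
Variables (R : realType) (n : nat) (delta : R).
Hypotheses (n0 : (0 < n)%N) (delta0 : 0 < delta).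
Let s : R := Num.sqrt n%:R.
Let b := `|Num.ceil s|%N.
Let gamma : R := (s + 8)^-1.

Lemma sqrtr_nat_ge1 : 1 <= s.
Proof. by rewrite /s -[leLHS](@sqrtr1 R) ler_wsqrtr// ler1n. Qed.

Let s1 := sqrtr_nat_ge1.

Lemma batch_size_itv : s <= b%:R /\ b%:R <= s + 1.
Proof. exact: natr_absz_ceil (le_trans ler01 s1). Qed.

Lemma batch_size_gt0 : (0 < b)%N.
Proof. by rewrite -(ltr0n R); have := batch_size_itv; have := s1; lra. Qed.

Lemma gamma_gt0 : 0 < gamma.
Proof. by rewrite invr_gt0; have := s1; lra. Qed.

Let gammaE : gamma * (s + 8) = 1.
Proof. by rewrite mulVf// gt_eqF//; have := s1; lra. Qed.

Lemma gamma_le_ninth : gamma <= 9^-1.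
Proof. by rewrite lef_pV2 ?posrE//; have := s1; lra. Qed.

(** From [s >= 1] and [b%:R >= s] one gets [s + 8 <= 9 * s <= 9 * b%:R]. *)
Lemma gamma_batch_ge : 1 <= 9 * gamma * b%:R.
Proof.
have [b1 _] := batch_size_itv; have g0 := ltW gamma_gt0.
by have := ler_wpM2l g0 b1; have := ler_wpM2l g0 s1; have := gammaE; lra.
Qed.

(** The expected cost of refreshing the full gradient in one round: of the order of the batch
    size. *)
Lemma gamma_mul_le : gamma * n%:R <= s.
Proof.
have -> : n%:R = s ^+ 2 by rewrite sqr_sqrtr.
have h : gamma * s <= 1 by have := gammaE; have := ltW gamma_gt0; lra.
by rewrite expr2 mulrA -[leRHS]mul1r ler_wpM2r// (le_trans ler01).
Qed.

(** [gamma * b%:R] is at least 1/9, hence more than 1/64, so the first argument of the minimum is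
    never the smaller one. *)
Lemma svogs_step_size :
  Num.min (Num.sqrt (gamma * b%:R) / (4 * delta)) (32 * delta)^-1 = (32 * delta)^-1.
Proof.
rewrite min_r//; have h : 8^-1 <= Num.sqrt (gamma * b%:R).
  rewrite -[leLHS]gtr0_norm// -sqrtr_sqr ler_wsqrtr//.
  by have := gamma_batch_ge; lra.
have -> : (32 * delta)^-1 = 8^-1 / (4 * delta) by field; rewrite gt_eqF.
by rewrite ler_wpM2r// invr_ge0 mulr_ge0// ltW.
Qed.

End StepSizes.

(** Taking roots gives [t <= eta * epsilon / (4 * W)], while the bracket is at most [W / eta]. *)
Lemma inexactness_budget (R : realFieldType) (eta L D M epsilon t : R) :
  0 < eta -> 0 < L -> 0 < D -> 0 <= M -> 0 < epsilon -> 0 <= t ->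
  t ^+ 2 <= eta ^+ 2 * epsilon ^+ 2 / (16 * (9 * eta * L * D + 3 * eta * M + D) ^+ 2) ->
  t * (M + 5 * (L * D) + D / eta) <= epsilon / 4.
Proof.
move=> eta0 L0 D0 M0 e0 t0; set W := 9 * eta * L * D + 3 * eta * M + D => tz.
have W0 : 0 < W by rewrite ltr_wpDl// addr_ge0// !mulr_ge0// ltW.
have tW : t <= eta * epsilon / (4 * W).
  have w0 : 0 <= eta * epsilon / (4 * W) by rewrite divr_ge0 ?mulr_ge0// ltW.
  rewrite -(@ler_pXn2r _ 2) ?nnegrE//; apply: le_trans tz _.
  rewrite le_eqVlt; apply/orP; left; apply/eqP.
  by field; rewrite gt_eqF.
have WE : M + 5 * (L * D) + D / eta <= W / eta.
  have -> : W / eta = 9 * (L * D) + 3 * M + D / eta by rewrite /W; field; rewrite gt_eqF.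
  by have := mulr_ge0 (ltW L0) (ltW D0); lra.
apply: le_trans (ler_wpM2l t0 WE) _.
apply: (@le_trans _ _ (eta * epsilon / (4 * W) * (W / eta))).
  by rewrite ler_wpM2r// divr_ge0// ltW.
by rewrite le_eqVlt; apply/orP; left; apply/eqP; field; rewrite !gt_eqF.
Qed.

(** A round costs at most [3 * s], and 768 is [3 * 256]; the extra round due to the ceiling is
    charged to [n >= s]. *)
Lemma comm_cost_arith (R : realDomainType) (n s q k b gn : R) :
  1 <= s -> n = s ^+ 2 -> 0 < q -> 0 <= k -> k <= 256 * q + 1 -> 0 <= b -> b <= s + 1 ->
  0 <= gn -> gn <= s -> n + k * (b + gn) <= 768 * (n + s * q).
Proof.
move=> s1 nE q0 k0 kq b0 bs g0 gs.
have h1 : b + gn <= 3 * s by lra.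
have h2 : k * (b + gn) <= (256 * q + 1) * (3 * s).
  by apply: ler_pM => //; exact: addr_ge0.
have h3 : s <= n by rewrite nE expr2 -[leLHS]mul1r ler_wpM2r//; lra.
have h4 : 0 <= s * q by rewrite mulr_ge0 ?(ltW q0)//; lra.
lra.
Qed.

(** There are at most [257 * (delta * Q)] rounds, and [delta * (eta * L + 1) <= 2 * L] turns rounds
    times inner steps into [L * Q] up to logarithms. *)
Lemma grad_cost_arith (R : realFieldType) (n s q k b gn T eta delta L Q Lg ME : R) :
  1 <= s -> 0 <= n -> 0 <= k -> k <= 256 * q + 1 -> 0 <= b -> b <= s + 1 ->
  0 <= gn -> gn <= s -> 0 < delta -> delta <= L -> eta * delta = 32^-1 ->
  0 < Q -> q <= delta * Q -> 1 <= delta * Q -> 1 <= Lg -> 1 <= ME ->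
  0 <= T -> T <= 4 * (eta * L + 1) * (600 * (Lg * ME)) + 1 ->
  n + k * (6 * b + 2 * T + gn) <= 500 * 500 * 12 * Lg * (n + (s * delta + L) * Q * ME).
Proof.
move=> s1 n0 k0 kq b0 bs g0 gs d0 dL ed Q0 qQ dQ1 Lg1 ME1 T0 TB.
have kQ : k <= 257 * (delta * Q) by lra.
set G := Lg * ME in TB *.
have G1 : 1 <= G by rewrite -[leLHS]mulr1; apply: ler_pM.
have -> : 500 * 500 * 12 * Lg * (n + (s * delta + L) * Q * ME) =
    500 * 500 * 12 * (n * Lg + s * (delta * Q) * G + L * Q * G) by rewrite /G; ring.
clearbody G.
have h1 : k * (6 * b + gn) <= 257 * (delta * Q) * (13 * s).
  by apply: ler_pM => //; [rewrite addr_ge0 ?mulr_ge0|lra].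
have h2 : k * T <= 257 * (delta * Q) * (4 * (eta * L + 1) * (600 * G) + 1) by exact: ler_pM.
have dQL : delta * Q <= L * Q by rewrite ler_wpM2r// ltW.
have eLd : delta * (eta * L + 1) <= 2 * L.
  have -> : delta * (eta * L + 1) = (eta * delta) * L + delta by ring.
  rewrite ed; lra.
have LQ0 : 0 <= L * Q by apply: le_trans dQL; lra.
have h3 : delta * Q * (4 * (eta * L + 1) * (600 * G) + 1) <= 500 * 10 * (L * Q * G).
  have e1 : delta * (eta * L + 1) * (Q * G) <= 2 * L * (Q * G).
    by rewrite ler_wpM2r// mulr_ge0 ?(ltW Q0)//; lra.
  have e2 : L * Q * 1 <= L * Q * G by rewrite ler_wpM2l.
  lra.
have s0 : 0 <= s := le_trans ler01 s1.
have sdQ : 0 <= s * (delta * Q) := mulr_ge0 s0 (le_trans ler01 dQ1).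
have h4 : s * (delta * Q) * 1 <= s * (delta * Q) * G by rewrite ler_wpM2l.
have h5 : n * 1 <= n * Lg by rewrite ler_wpM2l.
have h6 : 0 <= L * Q * G by rewrite mulr_ge0//; lra.
have h7 : 0 <= s * (delta * Q) * G by rewrite mulr_ge0//; lra.
have -> : k * (6 * b + 2 * T + gn) = k * (6 * b + gn) + 2 * (k * T) by ring.
move: (n * Lg) (s * (delta * Q) * G) (L * Q * G) (k * (6 * b + gn)) (k * T) h1 h2 h3 h4 h5 h6 h7.
clear -n0; move=> u v w y x h1 h2 h3 h4 h5 h6 h7.
lra.
Qed.

(** The gap bound covers every admissible choice of u^k, while the gradient count is for a run with
    a concrete solver. The maximum with [delta^-1] accounts for the at least one round performed:
    its subproblem alone takes of the order of [L / delta] gradients up to logarithms, even when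
    [delta * D ^+ 2 / epsilon] is below 1. *)
Theorem corollary1 (R : realType) :
  exists Cround Ccomm Cgrad : R,
  [/\ 0 < Cround, 0 < Ccomm & 0 < Cgrad] /\
  forall (n : nat) (n_gt0 : (0 < n)%N) (dx dy : nat)
    (X : set 'rV[R]_dx) (Y : set 'rV[R]_dy) (D L delta : R)
    (f : 'I_n -> 'rV[R]_(dx + dy) -> R) (z0 zstar : 'rV[R]_(dx + dy))
    (epsilon : R),
  let Z := prodset X Y in
  let i1 := Ordinal n_gt0 in
  Z !=set0 -> closed Z -> convex_set Z ->
  0 < D -> (forall z1 z2, Z z1 -> Z z2 -> enorm (z1 - z2) <= D) ->
  0 < delta -> delta <= L ->
  (forall i, twice_differentiable (f i)) ->
  smooth f L ->
  (forall i, convex_concave (f i)) ->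
  second_order_similar f delta ->
  Z z0 -> saddle X Y (favg f) zstar ->
  0 < epsilon ->
  let sqrtn := Num.sqrt (n%:R : R) in
  let b := `|Num.ceil sqrtn|%N in
  let p := (sqrtn + 8)^-1 in
  let gamma := p in
  let eta := Num.min (Num.sqrt (gamma * b%:R) / (4 * delta)) (32 * delta)^-1 in
  let alpha := 1 in
  let M := max_init_norm f z0 in
  let zeta :=
    Num.min
      (eta ^+ 2 * epsilon ^+ 2 /
         (16 * (9 * eta * L * D + 3 * eta * M + D) ^+ 2))
      (eta * epsilon / (4 * (12 * eta ^+ 2 * delta ^+ 2 + 1))) in
  let Phi0 :=
    eta^-1 * enorm (z0 - zstar) ^+ 2 +
    gamma / (p * eta) * enorm (z0 - zstar) ^+ 2 in
  let chat :=
    100 + 2048 * eta ^+ 2 * delta ^+ 2 + 64 * Num.sqrt (2 * eta * Phi0) in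
  let K := `|Num.ceil (Cround * (delta * D ^+ 2 / epsilon))|%N in
  let eps (tr : trace R (dx + dy) n b K) k om :=
    let r := enorm (uhats tr k om - zs tr k om) in
    Num.min zeta (chat^-1 * Num.min r (r ^+ 2)) in
  let run (tr : trace R (dx + dy) n b K) :=
    svogs_run X Y f i1 eta gamma alpha z0 (eps tr) tr in
  [/\ forall tr, run tr ->
        Expect p (fun om => Gap X Y (favg f) (uavg tr om)) <= epsilon,
      Expect p (@comm_cost R n b K)
        <= Ccomm * (n%:R + sqrtn * delta * D ^+ 2 / epsilon)
    & exists (tr : trace R (dx + dy) n b K)
             (T : nat -> outcome n b K -> nat),
        [/\ run tr, solved_by_eg X Y f i1 eta gamma alpha L tr T
          & Expect p (@grad_cost R n b K T)
              <= Cgrad * log_factor n L delta D M *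
                 (n%:R + (sqrtn * delta + L)
                         * Num.max (D ^+ 2 / epsilon) delta^-1
                         * Num.max 1 (ln epsilon^-1))]].
Proof.
(* 256 is chosen so that [164 / 256 + 1 / 4 <= 1] in the gap bound. *)
exists 256, 768, (500 * 500 * 12); split; first by split; rewrite ?mulr_gt0 ?ltr0n.
move=> n n_gt0 dx dy X Y D L delta f z0 zstar epsilon Z i1 Zne cZ cvZ D0 ZD d0 dL df2 fL cc sim Zz0 sad e0.
move=> sqrtn b p gamma eta alpha M zeta Phi0 chat K eps run.
have L0 : 0 < L := lt_le_trans d0 dL.
have df i z : differentiable (f i) z by have [] := df2 i.
have s1 : 1 <= sqrtn := sqrtr_nat_ge1 R n_gt0.
have [b1 b2] := batch_size_itv R n_gt0.
have b0 : (0 < b)%N := batch_size_gt0 R n_gt0.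
have g0 : 0 < gamma := gamma_gt0 R n_gt0.
have g9 : gamma <= 9^-1 := gamma_le_ninth R n_gt0.
have gb : 1 <= 9 * gamma * b%:R := gamma_batch_ge R n_gt0.
have gn : gamma * n%:R <= sqrtn := gamma_mul_le R n_gt0.
have gn0 : 0 <= gamma * n%:R by rewrite mulr_ge0// ltW.
have etaE : eta = (32 * delta)^-1 := svogs_step_size n_gt0 d0.
have eta0 : 0 < eta by rewrite etaE invr_gt0 mulr_gt0.
have fM i : enorm (gradop (f i) z0) <= M by rewrite /M /max_init_norm; exact: le_bigmax.
have M0 : 0 <= M := le_trans (enorm_ge0 _) (fM i1).
have zs : enorm (z0 - zstar) <= D by apply: ZD => //; case: sad.
(* As [gamma = p] and w^0 = z^0, both terms of [Phi0] agree and the root in [chat] is explicit. *)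
have PhiE : 2 * eta * Phi0 = (2 * enorm (z0 - zstar)) ^+ 2.
  by rewrite /Phi0 -/gamma; field; rewrite !gt_eqF.
have edE : eta * delta = 32^-1 by rewrite etaE; field; rewrite gt_eqF.
have chatE : chat = 102 + 128 * enorm (z0 - zstar).
  rewrite /chat PhiE sqrtr_sqr ger0_norm ?mulr_ge0 ?enorm_ge0//.
  have -> : 2048 * eta ^+ 2 * delta ^+ 2 = 2048 * (eta * delta) ^+ 2 by ring.
  by rewrite edE; field.
have [c100 c2] : 100 <= chat /\ chat <= 128 * (1 + D).
  by rewrite chatE; move: zs (enorm_ge0 (z0 - zstar)); clear; lra.
have c1 : 1 <= chat by move: c100; clear; lra.
set q := delta * D ^+ 2 / epsilon.
have q0 : 0 < q by rewrite /q divr_gt0 ?mulr_gt0 ?exprn_gt0.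
have [K1 K2] : 256 * q <= K%:R /\ K%:R <= 256 * q + 1.
  exact: natr_absz_ceil (mulr_ge0 (ler0n _ _) (ltW q0)).
have Kp : 0 < K%:R :> R := lt_le_trans (mulr_gt0 (ltr0Sn _ _) q0) K1.
have K0 : (0 < K)%N by rewrite -(ltr0n R).
have [zeta0 lnA] := ln_accuracy_le n_gt0 d0 dL D0 M0 e0 etaE (erefl zeta) c1 c2.
split.
- move=> tr rn.
  have := @svogs_expected_gap R dx dy n b K X Y f i1 eta gamma delta L D M epsilon zeta
    z0 (eps tr) tr n_gt0 b0 g0 g9 gb d0 dL etaE cvZ Zz0 ZD df cc fL.
  move=> /(_ _ fM rn) H; apply: le_trans (H _ _ _ _ K0) _.
  + by move=> i z1 z2; exact: similar_lipschitz.
  + by move=> k om; rewrite /eps ge_min lexx.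
  + move=> k om; rewrite /eps ge_min; apply/orP; right.
    apply: ler_pM; rewrite ?invr_ge0 ?le_min ?enorm_ge0 ?sqr_ge0//.
    * exact: le_trans c1.
    * by rewrite lef_pV2 ?posrE// (lt_le_trans _ c1).
    * by rewrite ge_min lexx orbT.
  + move=> t t0 tz; apply: inexactness_budget => //.
    by apply: le_trans tz _; rewrite /zeta ge_min lexx.
  have qE : delta * D ^+ 2 / K%:R <= epsilon / 256.
    rewrite ler_pdivrMr//; apply: (@le_trans _ _ (epsilon / 256 * (256 * q))).
      by rewrite /q le_eqVlt; apply/orP; left; apply/eqP; field; rewrite gt_eqF.
    apply: ler_wpM2l; last exact: K1.
    exact: divr_ge0 (ltW e0) (ler0n _ _).
  by move: qE e0; clear; lra.
- rewrite /comm_cost (Expect_refresh_cost b K gamma n_gt0).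
  have -> : sqrtn * delta * D ^+ 2 / epsilon = sqrtn * q by rewrite /q !mulrA.
  by apply: comm_cost_arith => //; rewrite sqr_sqrtr.
(* Contraction rate of one extra-gradient step; its inverse, [4 * (eta * L + 1)], is four times the
   condition number of the subproblem. *)
pose x : R := (4 * (L + eta^-1))^-1 * eta^-1.
have eL0 : 0 < eta * L by rewrite mulr_gt0.
have xE : x^-1 = 4 * (eta * L + 1).
  by rewrite /x; field; rewrite !gt_eqF// ?addr_gt0 ?mulr_gt0.
have xV1 : 1 <= x^-1 by rewrite xE; move: eL0; clear; lra.
have x0 : 0 < x by rewrite -invr_gt0; exact: lt_le_trans xV1.
have x1 : x <= 1 by rewrite -(invrK x) invf_le1// (lt_le_trans _ xV1).
set A := (1 + D ^+ 2 / zeta) * ((1 + D) * chat) in lnA.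
have lA0 : 0 <= ln A.
  apply: ln_ge0; rewrite -[leLHS]mulr1; apply: ler_pM => //.
    by rewrite lerDl divr_ge0 ?sqr_ge0// ltW.
  by rewrite -[leLHS]mulr1; apply: ler_pM => //; rewrite lerDl ltW.
set T := `|Num.ceil (ln A / x)|%N.
have [T1 T2] : ln A / x <= T%:R /\ T%:R <= ln A / x + 1.
  by apply: natr_absz_ceil; rewrite divr_ge0// ltW.
have TL r : 0 <= r -> r <= D ->
    (1 - (4 * (L + eta^-1))^-1 / eta) ^+ T * r ^+ 2 <= Num.min zeta (chat^-1 * Num.min r (r ^+ 2)).
  by apply: (eg_accuracy (ltW x0)) => //; rewrite -ler_pdivrMl// [leLHS]mulrC.
have [tr [rn sv]] := @svogs_eg_run_exists R dx dy n b K X Y f i1 eta gamma alpha L D zeta chat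
  z0 T eta0 L0 Zne cZ cvZ Zz0 ZD (df i1) (cc i1) (fL i1) TL.
exists tr, (fun _ _ => T); split=> //.
have -> : Expect p (@grad_cost R n b K (fun _ _ => T)) =
    n%:R + K%:R * ((6 * b + 2 * T)%N%:R + gamma * n%:R).
  rewrite -(Expect_refresh_cost b K gamma n_gt0); apply: eq_Expect => om.
  by rewrite /grad_cost; congr (_ + _)%N%:R; apply: eq_bigr => k _; rewrite addnAC.
rewrite natrD !natrM; apply: (@grad_cost_arith _ _ _ q _ _ _ _ eta) => //.
- by rewrite lt_max invr_gt0 d0 orbT.
- by rewrite /q -mulrA ler_wpM2l ?(ltW d0)// le_max lexx.
- by rewrite -[leLHS](mulfV (lt0r_neq0 d0)) ler_wpM2l ?(ltW d0)// le_max lexx orbT.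
- rewrite /log_factor -!addrA lerDl !addr_ge0 ?ln_ge0// ?ler1n//.
  by rewrite lerDl.
- by rewrite le_max lexx.
- apply: le_trans T2 _; rewrite lerD2r xE mulrC ler_wpM2l// -xE.
  exact: le_trans xV1.
Qed.
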